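(* Let $\hat{\mathcal O}\subset\mathbb R^n$ be a bounded connected Lipschitz domain, let $F\hat x=x_0+B\hat x$ with $x_0\in\mathbb R^n$ and $B\in\mathbb R^{n\times n}$ invertible, let $\mathcal O=F(\hat{\mathcal O})$, and for a function $v$ on $\mathcal O$ let $\hat v=v\circ F$ on $\hat{\mathcal O}$. Then the norms $\|\cdot\|_{L^2(\mathcal O),H^1_0(\mathcal O),s}$, $\|\cdot\|_{\sim,s,\mathcal O}$ and the semi-norms $|\cdot|_{s,\mathcal O}$, $|\cdot|_{L^2(\mathcal O),H^1(\mathcal O),s}$ are scalable of order $D_{\mathcal O}^{n-2s}$, in the following sense. For every $s\in(0,1)$ and every $v\in\tilde H^s(\mathcal O)$, $$D_{\mathcal O}^{n-2s}\rho_{\mathcal O}^{-n}D_{\hat{\mathcal O}}^{2s-n}\rho_{\hat{\mathcal O}}^{-2s}\,\|\hat v\|_{L^2(\hat{\mathcal O}),H^1_0(\hat{\mathcal O}),s}^2\le\|v\|_{L^2(\mathcal O),H^1_0(\mathcal O),s}^2\le D_{\mathcal O}^{n-2s}\rho_{\mathcal O}^{2s}D_{\hat{\mathcal O}}^{2s-n}\rho_{\hat{\mathcal O}}^{n}\,\|\hat v\|_{L^2(\hat{\mathcal O}),H^1_0(\hat{\mathcal O}),s}^2,$$ $$D_{\mathcal O}^{n-2s}\rho_{\mathcal O}^{-n}D_{\hat{\mathcal O}}^{2s-n}\rho_{\hat{\mathcal O}}^{-2s}\min\{\rho_{\mathcal O}^{-n}\rho_{\hat{\mathcal O}}^{-n},1\}\,\|\hat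 v\|_{\sim,s,\hat{\mathcal O}}^2\le\|v\|_{\sim,s,\mathcal O}^2\le D_{\mathcal O}^{n-2s}\rho_{\mathcal O}^{2s}D_{\hat{\mathcal O}}^{2s-n}\rho_{\hat{\mathcal O}}^{n}\max\{\rho_{\mathcal O}^{n}\rho_{\hat{\mathcal O}}^{n},1\}\,\|\hat v\|_{\sim,s,\hat{\mathcal O}}^2,$$ and for every $s\in(0,1)$ and every $v\in H^s(\mathcal O)$, $$D_{\mathcal O}^{n-2s}\rho_{\mathcal O}^{-n}D_{\hat{\mathcal O}}^{2s-n}\rho_{\hat{\mathcal O}}^{-2s}\,|\hat v|_{L^2(\hat{\mathcal O}),H^1(\hat{\mathcal O}),s}^2\le|v|_{L^2(\mathcal O),H^1(\mathcal O),s}^2\le D_{\mathcal O}^{n-2s}\rho_{\mathcal O}^{2s}D_{\hat{\mathcal O}}^{2s-n}\rho_{\hat{\mathcal O}}^{n}\,|\hat v|_{L^2(\hat{\mathcal O}),H^1(\hat{\mathcal O}),s}^2,$$ $$D_{\mathcal O}^{n-2s}\rho_{\mathcal O}^{-2n}D_{\hat{\mathcal O}}^{2s-n}\rho_{\hat{\mathcal O}}^{-n-2s}\,|\hat v|_{s,\hat{\mathcal O}}^2\le|v|_{s,\mathcal O}^2\le D_{\mathcal O}^{n-2s}\rho_{\mathcal O}^{n+2s}D_{\hat{\mathcal O}}^{2s-n}\rho_{\hat{\mathcal O}}^{2n}\,|\hat v|_{s,\hat{\mathcal O}}^2.$$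
   Context: Functions are real valued. For a bounded connected Lipschitz domain $\mathcal O\subset\mathbb R^n$, $\|\cdot\|_{0,\mathcal O}$ is the $L^2(\mathcal O)$-norm and $|v|_{1,\mathcal O}=\|\nabla v\|_{0,\mathcal O}$. $D_{\mathcal O}$ denotes the diameter of $\mathcal O$, $d_{\mathcal O}$ the supremum of the diameters of all balls contained in $\mathcal O$, and $\rho_{\mathcal O}=D_{\mathcal O}/d_{\mathcal O}$. For $0<s<1$: - $|v|_{s,\mathcal O}=\Bigl(\int_{\mathcal O}\int_{\mathcal O}\frac{|v(x)-v(y)|^2}{|x-y|^{n+2s}}\,dx\,dy\Bigr)^{1/2}$; $H^s(\mathcal O)$ is the space of $v\in L^2(\mathcal O)$ with $|v|_{s,\mathcal O}<\infty$. - $|v|_{L^2(\mathcal O),H^1(\mathcal O),s}=\Bigl(\int_0^\infty t^{-2s}\inf_{v=v_0+v_1}\bigl(\|v_0\|_{0,\mathcal O}^2+t^2|v_1|_{1,\mathcal O}^2\bigr)\frac{dt}{t}\Bigr)^{1/2}$, infimum over $v_0\in L^2(\mathcal O)$, $v_1\in H^1(\mathcal O)$ with $v_0+v_1=v$. - $\|v\|_{L^2(\mathcal O),H^1_0(\mathcal O),s}=\Bigl(\int_0^\infty t^{-2s}\inf_{v=v_0+v_1}\bigl(\|v_0\|_{0,\mathcal O}^2+t^2|v_1|_{1,\mathcal O}^2\bigr)\frac{dt}{t}\Bigr)^{1/2}$, infimum over $v_0\in L^2(\mathcal O)$, $v_1\in H^1_0(\mathcal O)$ with $v_0+v_1=v$.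 $\tilde H^s(\mathcal O)=[L^2(\mathcal O),H^1_0(\mathcal O)]_s$ is the space of $v\in L^2(\mathcal O)$ for which this norm is finite. - $\|v\|_{\sim,s,\mathcal O}=\Bigl(|v|_{s,\mathcal O}^2+\Bigl\|\frac{v(x)}{\operatorname{dist}(x,\partial\mathcal O)^s}\Bigr\|_{0,\mathcal O}^2\Bigr)^{1/2}$. *)

(* Defs.v *)
From HB Require Import structures.
From mathcomp Require Import all_boot all_order all_algebra.
From mathcomp Require Import all_classical all_reals all_analysis.

Set Implicit Arguments.
Unset Strict Implicit.
Unset Printing Implicit Defensive.
Import Order.TTheory GRing.Theory Num.Theory.
Import numFieldNormedType.Exports.

Local Open Scope classical_set_scope.
Local Open Scope ring_scope.

(* R^n is the type 'cV[R]_n of column vectors.  Its library topology and norm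
   are those of the maximum norm; all metric quantities below use the Euclidean
   norm [enorm] instead. *)

Definition measure_col_display : measure_display -> measure_display.
Proof. exact. Qed.

Section measurable_col.
Context {d} {T : sigmaRingType d}.
Variable n : nat.

Let coors : 'I_n -> 'cV[T]_n -> T := fun i x => x i ord0.

Let col_set0 : g_sigma_preimage coors set0.
Proof. exact: sigma_algebra0. Qed.

Let col_setC A : g_sigma_preimage coors A -> g_sigma_preimage coors (~` A).
Proof. exact: sigma_algebraC. Qed.

Let col_bigcup (F : _^nat) : (forall i, g_sigma_preimage coors (F i)) ->
  g_sigma_preimage coors (\bigcup_i (F i)).
Proof. exact: sigma_algebra_bigcup. Qed.

HB.instance Definition _ := @isMeasurable.Build (measure_col_display d)
  'cV[T]_n (g_sigma_preimage coors) col_set0 col_setC col_bigcup.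

End measurable_col.

Lemma measurable_coor d (T : sigmaRingType d) n (i : 'I_n) :
  measurable_fun [set: 'cV[T]_n] (fun x => x i ord0).
Proof.
move=> _ Y mY; rewrite setTI; apply: sub_sigma_algebra => /=.
rewrite -bigcup_seq/=; exists i => /=; first by rewrite mem_index_enum.
by exists Y => //; rewrite setTI.
Qed.

Lemma measurable_fun_colP d1 d2 (T1 : measurableType d1)
    (T2 : measurableType d2) n (f : T1 -> 'cV[T2]_n) :
  measurable_fun [set: T1] f <->
  forall i, measurable_fun [set: T1] (fun x => f x i ord0).
Proof.
split=> [mf i|mf].
  exact: (measurableT_comp (@measurable_coor _ T2 n i) mf).
move=> _ A; rewrite setTI; move: A.
apply: smallest_sub.
  split=> [|A mA|F mF].
  - by rewrite /= preimage_set0.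
  - by rewrite /= setTD -preimage_setC; exact: measurableC.
  - by rewrite /= preimage_bigcup; exact: bigcupT_measurable.
case: n => [|n] in f mf *; first by rewrite big_ord0.
rewrite -bigcup_mkord_ord; apply: bigcup_sub => i Ii.
by move=> A [B mB <-]; rewrite /= setTI -[X in measurable X]setTI; exact: mf.
Qed.

Definition vcons (R : realType) n (p : measurableTypeR R * 'cV[R]_n) : 'cV[R]_n.+1 :=
  \col_(i < n.+1) oapp (fun j => p.2 j ord0) p.1 (unlift ord0 i).

Lemma measurable_vcons (R : realType) n : measurable_fun setT (@vcons R n).
Proof.
apply/measurable_fun_colP => i.
case: (unliftP ord0 i) => [j ->|->].
  rewrite (_ : (fun _ => _) = (fun x : 'cV[R]_n => x j ord0) \o snd).
    exact: measurableT_comp (measurable_coor _) measurable_snd.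
  by apply/funext => p /=; rewrite mxE liftK.
rewrite (_ : (fun _ => _) = fst); first exact: measurable_fst.
by apply/funext => p /=; rewrite mxE unlift_none.
Qed.

Section lebesgue_step.
Local Open Scope ereal_scope.
Context (R : realType) (n : nat).
Variable m : {sigma_finite_measure set 'cV[R]_n -> \bar R}.

Definition lebesgue_step : set 'cV[R]_n.+1 -> \bar R :=
  pushforward (@lebesgue_measure R \x m) (@vcons R n).

Let mvcons_preimage (A : set 'cV[R]_n.+1) :
  measurable A -> measurable (@vcons R n @^-1` A).
Proof. by move=> mA; rewrite -[X in measurable X]setTI; exact: measurable_vcons. Qed.

Let lebesgue_step0 : lebesgue_step set0 = 0.
Proof. by rewrite /lebesgue_step /pushforward preimage_set0 measure0. Qed.

Let lebesgue_step_ge0 A : 0 <= lebesgue_step A.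
Proof. exact: (measure_ge0 (@lebesgue_measure R \x m)). Qed.

Let lebesgue_step_sigma_additive : semi_sigma_additive lebesgue_step.
Proof.
move=> F mF tF mUF; rewrite /lebesgue_step /pushforward preimage_bigcup.
apply: measure_semi_sigma_additive.
- by move=> k; exact: mvcons_preimage.
- apply/trivIsetP => /= i j _ _ ij; rewrite -preimage_setI.
  by move/trivIsetP : tF => /(_ _ _ _ _ ij) ->//; rewrite preimage_set0.
- by rewrite -preimage_bigcup; exact: mvcons_preimage.
Qed.

HB.instance Definition _ := isMeasure.Build _ _ _ lebesgue_step
  lebesgue_step0 lebesgue_step_ge0 lebesgue_step_sigma_additive.

Let measurable_uncons :
  measurable_fun setT (fun x : 'cV[R]_n.+1 =>
    ((x ord0 ord0 : measurableTypeR R), \col_(i < n) x (lift ord0 i) ord0)).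
Proof.
apply: measurable_fun_pair => /=; first exact: measurable_coor.
apply/measurable_fun_colP => i; under eq_fun do rewrite mxE.
exact: measurable_coor.
Qed.

Let lebesgue_step_sigma_finite : sigma_finite setT lebesgue_step.
Proof.
have /sigma_finiteP[F [TF ndF Foo]] := sigma_finiteT (@lebesgue_measure R).
have /sigma_finiteP[G [TG ndG Goo]] := sigma_finiteT m.
pose u (x : 'cV[R]_n.+1) :=
  ((x ord0 ord0 : measurableTypeR R), \col_(i < n) x (lift ord0 i) ord0).
have uK : cancel (@vcons R n) u.
  move=> [a y]; rewrite /u /vcons; congr pair; first by rewrite mxE unlift_none.
  by apply/colP => i; rewrite !mxE liftK.
exists (fun k => u @^-1` (F k `*` G k)).
  apply/esym; rewrite -subTset => x _.
  have [k _ Fk] : (\bigcup_k F k) (u x).1 by rewrite -TF.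
  have [l _ Gl] : (\bigcup_k G k) (u x).2 by rewrite -TG.
  exists (maxn k l) => //; split => /=.
  - by move: Fk; exact/subsetPset/ndF/leq_maxl.
  - by move: Gl; exact/subsetPset/ndG/leq_maxr.
move=> k; have [mF Fk] := Foo k; have [mG Gk] := Goo k; split.
  rewrite -[X in measurable X]setTI; apply: measurable_uncons => //.
  exact: measurableX.
rewrite /lebesgue_step /pushforward -comp_preimage.
rewrite (_ : u \o _ = id); last exact/funext.
by rewrite preimage_id product_measure1E// lte_mul_pinfty// ge0_fin_numE.
Qed.

HB.instance Definition _ := Measure_isSigmaFinite.Build _ _ _ lebesgue_step
  lebesgue_step_sigma_finite.

End lebesgue_step.

Fixpoint lebesgueRn (R : realType) (n : nat) :
    {sigma_finite_measure set 'cV[R]_n -> \bar R} :=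
  match n with
  | 0 => \d_(0 : 'cV[R]_0)
  | n'.+1 => lebesgue_step (lebesgueRn R n')
  end.

Lemma lebesgueRn_box (R : realType) n (a b : 'cV[R]_n) :
  (forall i, a i ord0 <= b i ord0) ->
  lebesgueRn R n [set x : 'cV[R]_n | forall i, a i ord0 <= x i ord0 <= b i ord0]
  = (\prod_(i < n) (b i ord0 - a i ord0))%:E.
Proof.
have mbox k (c e : 'cV[R]_k) :
    measurable [set x : 'cV[R]_k | forall i, c i ord0 <= x i ord0 <= e i ord0].
  rewrite (_ : [set _ | _] = \bigcap_(i in [set: 'I_k])
     ((fun x : 'cV[R]_k => x i ord0) @^-1` `[c i ord0, e i ord0]%classic)).
    apply: fin_bigcap_measurable => // i _.
    rewrite -[X in measurable X]setTI.
    exact: measurable_coor.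
  by apply/seteqP; split=> x /= h i; [move=> _|]; have := h i; rewrite /= in_itv/=; exact.
elim: n a b => [|n IHn] a b ab.
  by rewrite big_ord0 /= diracE mem_set//= => -[].
rewrite big_ord_recl EFinM.
rewrite [LHS](_ : _ = (@lebesgue_measure R \x lebesgueRn R n)%E
  (@vcons R n @^-1` [set x : 'cV[R]_n.+1 | forall i, a i ord0 <= x i ord0 <= b i ord0]))//.
pose a' := \col_(i < n) a (lift ord0 i) ord0.
pose b' := \col_(i < n) b (lift ord0 i) ord0.
rewrite (_ : @vcons R n @^-1` _ =
   (`[a ord0 ord0, b ord0 ord0]%classic : set (measurableTypeR R)) `*`
   [set x : 'cV[R]_n | forall i, a' i ord0 <= x i ord0 <= b' i ord0]); last first.
  apply/seteqP; split=> -[x y] /=.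
    move=> h; split; first by have := h ord0; rewrite mxE unlift_none /= in_itv.
    by move=> i; have := h (lift ord0 i); rewrite !mxE liftK.
  move=> [xab h] i; rewrite mxE; case: (unliftP ord0 i) => [j|] -> /=.
    by have := h j; rewrite !mxE.
  by move: xab; rewrite in_itv.
rewrite product_measure1E//=; last exact: mbox.
rewrite IHn; last by move=> i; rewrite !mxE.
congr (_ * _)%E; last by congr EFin; apply: eq_bigr => i _; rewrite !mxE.
rewrite lebesgue_measure_itv /= lte_fin.
have := ab ord0; rewrite le_eqVlt => /orP[/eqP ->|->].
  by rewrite ltxx subrr.
by rewrite EFinB.
Qed.

Section geometry.
Context {R : realType} {n : nat}.
Implicit Types (x y : 'cV[R]_n) (A O : set 'cV[R]_n).

Definition enorm x : R := Num.sqrt (\sum_(i < n) x i ord0 ^+ 2).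

Definition eball x (r : R) : set 'cV[R]_n := [set y | enorm (x - y) < r].

Definition bdry A : set 'cV[R]_n := closure A `\` interior A.

(* [sup] and [inf] are meaningful below for nonempty bounded sets only, which is
   the case for bounded domains when n > 0. *)
Definition diam A : R := sup [set enorm (x - y) | x in A & y in A].

Definition inball_diam O : R :=
  sup [set diam (eball p.1 p.2) |
         p in [set p : 'cV[R]_n * R | 0 < p.2 /\ eball p.1 p.2 `<=` O]].

Definition chunkiness O : R := diam O / inball_diam O.

Definition dist x A : R := inf [set enorm (x - y) | y in A].

(* Near each boundary point, and in the rotated coordinates [Q *m y], O is the
   strict hypograph of a Lipschitz function of all coordinates but one. The
   library's [lipschitz] uses the maximum norm; this does not affect the notion. *)
Definition lipschitz_boundary O := forall x, bdry O x ->
  exists (i : 'I_n) (Q : 'M[R]_n) (zeta : 'cV[R]_n.-1 -> R),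
    [/\ Q^T *m Q = 1%:M, lipschitz zeta &
        \forall y \near x,
          O y <-> (Q *m y) i ord0 < zeta (row' i (Q *m y))].

Definition lipschitz_domain O :=
  [/\ O !=set0, open O, bounded_set O, connected O & lipschitz_boundary O].

End geometry.

(* Functions on O are represented by functions on R^n whose values outside O are
   irrelevant. Norms take values in \bar R, with +oo for functions outside the
   corresponding space. *)
Section spaces.
Context {R : realType} {n : nat}.
Local Notation mu := (lebesgueRn R n).
Local Notation vec := 'cV[R]_n.
Implicit Types (O : set vec) (v f phi : vec -> R) (g : vec -> vec) (s : R).

Definition l2norm O f : \bar R :=
  sqrte (\int[mu]_(x in O) (`|f x| ^+ 2)%:E).

Definition in_L2 O f := measurable_fun O f /\ (l2norm O f < +oo)%E.

Definition partial (i : 'I_n) f : vec -> R :=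
  fun x => 'D_(delta_mx i ord0 : vec) f x.

Fixpoint is_Ck (k : nat) f : Prop :=
  continuous f /\
  match k with
  | 0 => True
  | k'.+1 =>
      (forall (i : 'I_n) x, derivable f x (delta_mx i ord0 : vec)) /\
      (forall i : 'I_n, is_Ck k' (partial i f))
  end.

(* C_c^oo(O) *)
Definition test_function O phi :=
  (forall k, is_Ck k phi) /\
  exists K : set vec, [/\ compact K, K `<=` O & forall x, ~ K x -> phi x = 0].

Definition weak_gradient O v g :=
  forall phi (i : 'I_n), test_function O phi ->
    (\int[mu]_(x in O) (v x * partial i phi x)%:E =
     - \int[mu]_(x in O) (g x i ord0 * phi x)%:E)%E.

Definition L2_weak_gradients O v : set (vec -> vec) :=
  [set g : vec -> vec | (forall i : 'I_n, in_L2 O (fun x => g x i ord0)) /\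
           weak_gradient O v g].

Definition in_H1 O v := in_L2 O v /\ L2_weak_gradients O v !=set0.

(* ||grad v||_{0,O}.  The weak gradient is unique almost everywhere, so that the
   infimum ranges over a single value when v is in H^1(O). *)
Definition h1seminorm O v : \bar R :=
  ereal_inf [set l2norm O (fun x => enorm (g x)) | g in L2_weak_gradients O v].

Definition h1norm O v : \bar R :=
  sqrte (l2norm O v ^+ 2 + h1seminorm O v ^+ 2)%E.

(* the closure of C_c^oo(O) in H^1(O) *)
Definition in_H10 O v := in_H1 O v /\
  forall eps : R, 0 < eps -> exists2 phi, test_function O phi &
    (h1norm O (v \- phi)%R < eps%:E)%E.

(* V is meant to be H^1(O) or H^1_0(O) *)
Definition K_functional O (V : (vec -> R) -> Prop) (t : R) v : \bar R :=
  ereal_inf [set (l2norm O vv.1 ^+ 2 + (t ^+ 2)%:E * h1seminorm O vv.2 ^+ 2)%E |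
    vv in [set vv : (vec -> R) * (vec -> R) |
      [/\ in_L2 O vv.1, V vv.2 &
          {ae mu, forall x, O x -> v x = vv.1 x + vv.2 x}]]].

Definition interp_norm O (V : (vec -> R) -> Prop) s v : \bar R :=
  sqrte (\int[lebesgue_measure]_(t in `]0%R, +oo[)
    ((t `^ (- (2 * s)))%:E * K_functional O V t v * (t^-1)%:E))%E.

Definition interp_L2_H1 O s v : \bar R := interp_norm O (in_H1 O) s v.

Definition interp_L2_H10 O s v : \bar R := interp_norm O (in_H10 O) s v.

Definition slobodeckij O s v : \bar R :=
  sqrte (\int[mu]_(y in O) \int[mu]_(x in O)
    (`|v x - v y| ^+ 2 / enorm (x - y) `^ (n%:R + 2 * s))%:E)%E.

Definition tilde_norm O s v : \bar R :=
  sqrte (slobodeckij O s v ^+ 2 +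
         l2norm O (fun x => v x / dist x (bdry O) `^ s)%R ^+ 2)%E.

Definition in_Hs O s v := in_L2 O v /\ (slobodeckij O s v < +oo)%E.

Definition in_tildeHs O s v := in_L2 O v /\ (interp_L2_H10 O s v < +oo)%E.

End spaces.

(* Main.v *)
(* F and its inverse are both affine, so it suffices to treat an affine map
   G x = a + A x and the preimage O' of O under G, and to bound the norms of v o G
   on O' by those of v on O. If |A x| <= b |x| and preimages under G have c times
   the original measure, a change of variables (together with t -> b t in the
   K-functional) yields the factor c b^(2s) for the interpolation norms and for the
   weighted L2-norm, and c^2 b^(n+2s) for the Slobodeckij seminorm.
   The balls contained in O' are mapped into O, whence b = D_O / d_O' is admissible;
   likewise |A^-1 x| <= b' |x| with b' = D_O' / d_O. The preimage of the unit ball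
   under A lies in the ball of radius b', so c <= b'^n. The existence of c follows
   from the uniqueness of translation-invariant measures, without determinants. *)

Require Import Defs.
From HB Require Import structures.
From mathcomp Require Import all_boot all_order all_algebra.
From mathcomp Require Import all_classical all_reals all_analysis.
From mathcomp Require Import measurable_realfun ring lra.

Set Implicit Arguments.
Unset Strict Implicit.
Unset Printing Implicit Defensive.
Import Order.TTheory GRing.Theory Num.Theory.
Import numFieldNormedType.Exports.

Local Open Scope classical_set_scope.
Local Open Scope ring_scope.

(** * Integrals without measurability assumptions *)

(** Two obstacles shape the development. No measurability is established for the K-functional in t
    or for the inner integral of the Slobodeckij seminorm, so substitution, monotonicity and
    homogeneity are proved for arbitrary integrands; it suffices that the substitution is a
    bijection, measurable in both directions, that scales the measure. Smoothness and weak gradients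
    are expressed through partial derivatives, so transporting test functions requires the chain
    rule from continuous partial derivatives alone; gradients then transform by A^T, which obeys the
    same Euclidean bound b as A.

    The constants of the theorem are those of the method in another grouping: b'^n b^(2s) with b =
    D_O / d_O' and b' = D_O' / d_O is a monomial in the four diameters, and so is each stated
    factor. The maximum arises because c^2 b^(n+2s) is c b^(2s) times c b^n, whereas the weighted
    L2-norm only costs c b^(2s); moreover c b^n is at most (b b')^n, the product of the n-th powers
    of the two chunkiness ratios. *)

Section integral_without_measurability.
Local Open Scope ereal_scope.
Context {R : realType}.

Import HBNNSimple.

(* The integral of a nonnegative function is a supremum over the simple functions
   below it, so this and the following lemmas hold for nonmeasurable functions. *)
Lemma le_ge0_integral d (T : measurableType d) (mu : {measure set T -> \bar R})
    (D : set T) (f g : T -> \bar R) :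
  (forall x, D x -> 0 <= f x) -> (forall x, D x -> f x <= g x) ->
  \int[mu]_(x in D) f x <= \int[mu]_(x in D) g x.
Proof.
move=> f0 fg; rewrite !ge0_integralE//; last first.
  by move=> x Dx; exact: le_trans (f0 _ Dx) (fg _ Dx).
apply: ereal_sup_le => _ [h hf <-]; exists h => // x.
apply: le_trans (hf x) _; rewrite !patchE; case: ifPn => //.
by rewrite inE; exact: fg.
Qed.

Lemma nnsfun_comp d1 d2 (X : measurableType d1) (Y : measurableType d2)
    (phi : X -> Y) (h : {nnsfun Y >-> R}) :
  measurable_fun setT phi ->
  exists k : {nnsfun X >-> R}, k =1 h \o phi.
Proof.
move=> mphi.
have m : measurable_fun setT (h \o phi) by exact: measurableT_comp.
have fi : finite_set (range (h \o phi)).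
  apply: sub_finite_set (fimfunP h) => _ [x _ <-].
  by exists (phi x).
have nn x : (0 <= (h \o phi) x)%R by exact: fun_ge0.
pose k : {nnsfun X >-> R} := HB.pack (h \o phi)
  (isMeasurableFun.Build _ _ _ _ (h \o phi) m)
  (FiniteImage.Build _ _ (h \o phi) fi)
  (isNonNegFun.Build _ _ (h \o phi) nn).
by exists k.
Qed.

Section change_of_variables.
Context d1 d2 (X : measurableType d1) (Y : measurableType d2).
Implicit Types (mu : {measure set X -> \bar R}) (nu : {measure set Y -> \bar R}).

Lemma sintegral_comp mu nu (phi : X -> Y) (c : R) (h : {nnsfun Y >-> R}) :
  (0 <= c)%R ->
  (forall S, measurable S -> mu (phi @^-1` S) = c%:E * nu S) ->
  sintegral mu (h \o phi) = c%:E * sintegral nu h.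
Proof.
move=> c0 muE; rewrite !sintegralET ge0_mule_fsumr; last exact: nnsfun_mulemu_ge0.
by apply: eq_fsbigr => r _; rewrite comp_preimage muE// muleCA.
Qed.

(** A simple function below [f] pulls back to one below [f \o phi]. Only one inequality results,
    since a simple function below [f \o phi] need not factor through [phi]. *)
Lemma ge0_integral_comp_ge mu nu (phi : X -> Y) (c : R) (f : Y -> \bar R) :
  measurable_fun setT phi -> (0 < c)%R ->
  (forall S, measurable S -> mu (phi @^-1` S) = c%:E * nu S) ->
  (forall y, 0 <= f y) ->
  c%:E * \int[nu]_y f y <= \int[mu]_x f (phi x).
Proof.
move=> mphi c0 muE f0; rewrite !ge0_integralTE// muleC -lee_pdivlMr//.
apply: ge_ereal_sup => _ [h hf <-].
rewrite lee_pdivlMr// muleC -(sintegral_comp _ (ltW c0) muE).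
have [k kE] := nnsfun_comp h mphi.
rewrite -(eq_sintegral _ _ kE); apply: ereal_sup_ubound; exists k => // x.
by rewrite kE; exact: hf.
Qed.

End change_of_variables.

Section change_of_variables_bijection.
Context d1 d2 (X : measurableType d1) (Y : measurableType d2).
Variables (mu : {measure set X -> \bar R}) (nu : {measure set Y -> \bar R}).
Variables (phi : X -> Y) (psi : Y -> X) (c : R).
Hypotheses (mphi : measurable_fun setT phi) (mpsi : measurable_fun setT psi).
Hypotheses (phiK : cancel phi psi) (psiK : cancel psi phi).
Hypotheses (c0 : (0 < c)%R)
  (muE : forall S, measurable S -> mu (phi @^-1` S) = c%:E * nu S).

(** The missing inequality is the previous one for [psi], [c^-1] and the integrand [f \o phi]. *)
Let ge0_integral_compT (f : Y -> \bar R) : (forall y, 0 <= f y) ->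
  \int[mu]_x f (phi x) = c%:E * \int[nu]_y f y.
Proof.
move=> f0; apply/eqP; rewrite eq_le ge0_integral_comp_ge// andbT.
have nuE S : measurable S -> nu (psi @^-1` S) = (c^-1)%:E * mu S.
  move=> mS; have mpS : measurable (psi @^-1` S).
    by rewrite -[X in measurable X]setTI; exact: mpsi.
  have := muE mpS; rewrite -comp_preimage (_ : psi \o phi = id); last exact/funext.
  by rewrite preimage_id => ->; rewrite muleA -EFinM mulVf ?gt_eqF// mul1e.
have := @ge0_integral_comp_ge _ _ _ _ nu mu psi c^-1 (f \o phi) mpsi.
rewrite invr_gt0 => /(_ c0 nuE (fun x => f0 _)) /=.
under [X in _ <= X]eq_integral do rewrite psiK.
by rewrite muleC lee_pdivrMr// muleC.
Qed.

Lemma integral_comp_bij (D : set Y) (f : Y -> \bar R) :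
  \int[mu]_(x in phi @^-1` D) f (phi x) = c%:E * \int[nu]_(y in D) f y.
Proof.
rewrite integral_mkcond [in RHS]integral_mkcond.
rewrite (_ : _ \_ _ = (f \_ D) \o phi); last first.
  by apply/funext => x /=; rewrite !patchE; congr (if _ then _ else _).
set g := f \_ D; rewrite integralE [in RHS]integralE.
under [X in X - _]eq_integral do rewrite funepos_comp/=.
under [X in _ - X]eq_integral do rewrite funeneg_comp/=.
rewrite !(ge0_integral_compT (f := _ ^\+))// !(ge0_integral_compT (f := _ ^\-))//.
have ge0p := integral_ge0 (f := g ^\+) nu (D := setT) (fun x _ => funepos_ge0 g x).
have ge0n := integral_ge0 (f := g ^\-) nu (D := setT) (fun x _ => funeneg_ge0 g x).
move: ge0p ge0n.
(* The infinite cases are checked by hand; when both parts have infinite integral, [+oo - +oo] is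
   [-oo] on either side. *)
case: (\int[nu]_x (g ^\+) x) => [a| |]; case: (\int[nu]_x (g ^\-) x) => [b| |]//.
- by move=> _ _; rewrite [RHS]muleBr.
- by rewrite gt0_muley ?lte_fin// -EFinM /= gt0_muleNy ?lte_fin.
- by rewrite gt0_muley ?lte_fin// -EFinM /= gt0_muley ?lte_fin.
- by rewrite gt0_muley ?lte_fin//= gt0_muleNy ?lte_fin.
Qed.

End change_of_variables_bijection.

(** Scaling the simple functions below [f] gives one inequality; the same inequality for [k^-1] and
    [k f] gives the other. *)
Lemma ge0_integralZ d (T : measurableType d) (mu : {measure set T -> \bar R})
    (D : set T) (f : T -> \bar R) (k : R) : (0 < k)%R ->
  (forall x, D x -> 0 <= f x) ->
  \int[mu]_(x in D) (k%:E * f x) = k%:E * \int[mu]_(x in D) f x.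
Proof.
have le (g : T -> \bar R) (a : R) : (0 < a)%R -> (forall x, D x -> 0 <= g x) ->
    a%:E * \int[mu]_(x in D) g x <= \int[mu]_(x in D) (a%:E * g x).
  move=> a0 g0; rewrite !ge0_integralE//; last first.
    by move=> x Dx; apply: mule_ge0; [rewrite lee_fin ltW|exact: g0].
  rewrite muleC -lee_pdivlMr//.
  apply: ge_ereal_sup => _ [h hf <-].
  rewrite lee_pdivlMr// muleC -sintegralrM.
  apply: ereal_sup_ubound; exists (scale_nnsfun h (ltW a0)) => // x /=.
  rewrite EFinM; have := hf x; rewrite !patchE; case: ifP => _ hx.
    by rewrite lee_pmul2l// lte_fin.
  rewrite (_ : h x = 0%R) ?mule0//.
  by apply/eqP; rewrite eq_le -lee_fin hx/=; exact: fun_ge0.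
move=> k0 f0; apply/eqP; rewrite eq_le le// andbT.
have := le (fun x => k%:E * f x) (k^-1)%R.
rewrite invr_gt0 => /(_ k0) H.
rewrite -lee_pdivrMl//; apply: le_trans (H _) _.
  by move=> x Dx; apply: mule_ge0; [rewrite lee_fin ltW|exact: f0].
rewrite (_ : (fun x => _) = f)//.
by apply/funext => x; rewrite muleA -EFinM mulVf ?gt_eqF// mul1e.
Qed.

End integral_without_measurability.

(** * Lebesgue measure on the line under translation and dilation *)

Section lebesgue_affine.
Context {R : realType}.
Local Notation leb := (@lebesgue_measure R).
Local Open Scope ereal_scope.

(** The push-forward under the translation agrees with Lebesgue measure on half-open intervals,
    which determine it. *)
Lemma lebesgue_measureD (a : R) (A : set (measurableTypeR R)) : measurable A ->
  leb ((fun x : measurableTypeR R => (x + a)%R : measurableTypeR R) @^-1` A) = leb A.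
Proof.
move=> mA.
pose phi := (fun x : measurableTypeR R => (x + a)%R : measurableTypeR R).
have mphi : measurable_fun setT phi.
  exact: (measurable_funD (@measurable_id _ _ _) (measurable_cst a)).
pose mf : {mfun _ >-> _} := HB.pack phi (isMeasurableFun.Build _ _ _ _ _ mphi).
apply/esym.
apply: (@lebesgue_measure_unique R (pushforward leb mf)) => // _ [[u w]] _ <-.
rewrite /= /pushforward (_ : mf @^-1` _ = `](u - a)%R, (w - a)%R]%classic).
  rewrite !lebesgue_measure_itv/= !lte_fin ltrD2r -!EFinB.
  by case: ifPn => // _; congr EFin; ring.
by apply/seteqP; split => x /=; rewrite /phi !in_itv/= ltrBlDr lerBrDr.
Qed.

(** Uniqueness on half-open intervals again, now for [a] times the push-forward; [a > 0] keeps the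
    intervals closed on the same side. *)
Lemma lebesgue_measureZ (a : R) (A : set (measurableTypeR R)) : (0 < a)%R ->
  measurable A ->
  leb ((fun x : measurableTypeR R => (a * x)%R : measurableTypeR R) @^-1` A) =
  (a^-1)%:E * leb A.
Proof.
move=> a0 mA.
pose phi := (fun x : measurableTypeR R => (a * x)%R : measurableTypeR R).
have mphi : measurable_fun setT phi.
  exact: (measurable_funM (measurable_cst a) (@measurable_id _ _ _)).
pose mf : {mfun _ >-> _} := HB.pack phi (isMeasurableFun.Build _ _ _ _ _ mphi).
pose aa : {nonneg R} := NngNum (ltW a0).
have [nu nuB] : exists nu : {measure set (measurableTypeR R) -> \bar R},
    forall B, nu B = a%:E * leb (phi @^-1` B).
  by unshelve eexists (mscale aa (pushforward leb mf)).
have nuE X : ocitv X -> leb X = nu X.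
  move=> [[u w]] _ <-.
  rewrite nuB.
  rewrite (_ : phi @^-1` _ = `](a^-1 * u)%R, (a^-1 * w)%R]%classic).
    rewrite !lebesgue_measure_itv/= !lte_fin ltr_pM2l ?invr_gt0// -!EFinB.
    case: ifPn => // _; last by rewrite mule0.
    by rewrite -mulrBr -EFinM mulrA mulfV ?gt_eqF// mul1r.
  apply/seteqP; split => x /=; rewrite /phi !in_itv/=.
    by rewrite -ltr_pdivrMl// -ler_pdivlMl.
  by rewrite -ltr_pdivrMl// -ler_pdivlMl.
rewrite (lebesgue_measure_unique nuE mA) nuB.
by rewrite muleA -EFinM mulVf ?gt_eqF// mul1e.
Qed.

(** This is the substitution that turns the K-functional at b t into the one at t. *)
Lemma integral_scale (b : R) (f : R -> \bar R) : (0 < b)%R ->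
  \int[leb]_(t in `]0%R, +oo[) f (b * t)%R =
  (b^-1)%:E * \int[leb]_(t in `]0%R, +oo[) f t.
Proof.
move=> b0.
pose phi := (fun x : measurableTypeR R => (b * x)%R : measurableTypeR R).
pose psi := (fun x : measurableTypeR R => (b^-1 * x)%R : measurableTypeR R).
have mphi : measurable_fun setT phi.
  exact: (measurable_funM (measurable_cst b) (@measurable_id _ _ _)).
have mpsi : measurable_fun setT psi.
  exact: (measurable_funM (measurable_cst b^-1%R) (@measurable_id _ _ _)).
have phiK : cancel phi psi by move=> x; rewrite /phi /psi mulKf ?gt_eqF.
have psiK : cancel psi phi by move=> x; rewrite /phi /psi mulVKf ?gt_eqF.
have bV0 : (0 < b^-1)%R by rewrite invr_gt0.
have phiE S : measurable S -> leb (phi @^-1` S) = (b^-1)%:E * leb S.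
  exact: lebesgue_measureZ.
rewrite -(integral_comp_bij mphi mpsi phiK psiK bV0 phiE).
congr (integral _ _ _); apply/seteqP; split => t; rewrite /= /phi !in_itv/= !andbT.
  by move=> t0; rewrite mulr_gt0.
by rewrite pmulr_rgt0.
Qed.

End lebesgue_affine.

(** * Lebesgue measure under affine maps *)

Section lebesgueRn_translation.
Context {R : realType}.

Lemma measurable_preimage d1 d2 (X : measurableType d1) (Y : measurableType d2)
    (f : X -> Y) (A : set Y) :
  measurable_fun setT f -> measurable A -> measurable (f @^-1` A).
Proof. by move=> mf mA; rewrite -[X in measurable X]setTI; exact: mf. Qed.

Lemma measurable_col_add n d (T : measurableType d) (f g : T -> 'cV[R]_n) :
  measurable_fun setT f -> measurable_fun setT g ->
  measurable_fun setT (fun x => f x + g x).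
Proof.
move=> mf mg; apply/measurable_fun_colP => i.
under eq_fun do rewrite mxE.
by apply: measurable_funD; [move: mf|move: mg] => /measurable_fun_colP; exact.
Qed.

Lemma measurable_mulmx m n (A : 'M[R]_(m, n)) :
  measurable_fun setT (fun x : 'cV[R]_n => A *m x).
Proof.
apply/measurable_fun_colP => i.
under eq_fun do rewrite mxE.
apply: measurable_sum => j.
by apply: measurable_funM; [exact: measurable_cst|exact: measurable_coor].
Qed.

Lemma measurable_affine m n (a : 'cV[R]_m) (A : 'M[R]_(m, n)) :
  measurable_fun setT (fun x : 'cV[R]_n => a + A *m x).
Proof.
by apply: measurable_col_add; [exact: measurable_cst|exact: measurable_mulmx].
Qed.

(** A section of the translated set is a translate of a section of [A], taken at the translated
    first coordinate. The induction hypothesis treats the sections, translation on the line treats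
    the outer integral. *)
Lemma lebesgueRn_shift n (a : 'cV[R]_n) (A : set 'cV[R]_n) : measurable A ->
  lebesgueRn R n ((fun x => x + a) @^-1` A) = lebesgueRn R n A.
Proof.
elim: n a A => [|n IHn] a A mA.
  by congr (lebesgueRn R 0 _); apply/seteqP; split => x /=; rewrite !flatmx0.
pose a' := \col_(i < n) a (lift ord0 i) ord0.
pose C := @vcons R n @^-1` A.
have mC : measurable C by apply: measurable_preimage => //; exact: measurable_vcons.
rewrite [RHS](_ : _ = (@lebesgue_measure R \x lebesgueRn R n)%E C)//.
rewrite [LHS](_ : _ = (@lebesgue_measure R \x lebesgueRn R n)%E
  (@vcons R n @^-1` ((fun x => x + a) @^-1` A)))//.
rewrite /product_measure1.
pose phi := (fun x : measurableTypeR R => (x + a ord0 ord0) : measurableTypeR R).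
pose psi := (fun x : measurableTypeR R => (x - a ord0 ord0) : measurableTypeR R).
have mphi : measurable_fun setT phi.
  exact: (measurable_funD (@measurable_id _ _ _) (measurable_cst (a ord0 ord0))).
have mpsi : measurable_fun setT psi.
  exact: (measurable_funD (@measurable_id _ _ _) (measurable_cst (- a ord0 ord0))).
have phiK : cancel phi psi by move=> x; rewrite /phi /psi addrK.
have psiK : cancel psi phi by move=> x; rewrite /phi /psi subrK.
transitivity (\int[@lebesgue_measure R]_(x in phi @^-1` setT)
    (lebesgueRn R n \o xsection C) (phi x))%E.
  rewrite preimage_setT; apply: eq_integral => x _ /=.
  rewrite -[RHS](IHn a'); last exact: measurable_xsection.
  congr (lebesgueRn R n _); apply/seteqP; split=> y /=.
    rewrite /xsection/= !inE/= /C /=.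
    rewrite (_ : vcons (x, y) + a = vcons (phi x, y + a'))//.
    apply/colP => i; rewrite !mxE; case: (unliftP ord0 i) => [j|] -> /=;
      by rewrite ?liftK ?unlift_none/= ?mxE.
  rewrite /xsection/= !inE/= /C /=.
  rewrite (_ : vcons (x, y) + a = vcons (phi x, y + a'))//.
  apply/colP => i; rewrite !mxE; case: (unliftP ord0 i) => [j|] -> /=;
    by rewrite ?liftK ?unlift_none/= ?mxE.
have phiE S : measurable S ->
    lebesgue_measure (phi @^-1` S) = (1%:E * @lebesgue_measure R S)%E.
  by move=> mS; rewrite mul1e; exact: lebesgue_measureD.
by rewrite (integral_comp_bij mphi mpsi phiK psiK ltr01 phiE) mul1e.
Qed.

End lebesgueRn_translation.

Section product_measure_sections.
Local Open Scope ereal_scope.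
Context d1 d2 (T1 : measurableType d1) (T2 : measurableType d2) (R : realType).
Variable m1 : {sigma_finite_measure set T1 -> \bar R}.
Variable m2 : {sigma_finite_measure set T2 -> \bar R}.

Lemma product_measure12 (W : set (T1 * T2)) : measurable W ->
  (m1 \x m2) W = (m1 \x^ m2) W.
Proof.
by apply: product_measure_unique => A B mA mB; exact: product_measure2E.
Qed.

Lemma product_measure1_sections (W : set (T1 * T2)) (S : set T1) k :
  measurable S -> 0 <= k ->
  (forall x, S x -> m2 (xsection W x) = k) ->
  (forall x, ~ S x -> xsection W x = set0) ->
  (m1 \x m2) W = m1 S * k.
Proof.
move=> mS k0 Wk W0; rewrite /product_measure1.
rewrite (eq_integral (fun x => (\1_S x)%:E * k)); last first.
  move=> x _ /=; rewrite indicE; case: (pselect (S x)) => Sx.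
    by rewrite Wk// mem_set//= mul1e.
  by rewrite W0// memNset//= mul0e measure0.
by rewrite ge0_integralZr ?integral_indic ?setIT//; exact: measurableT_comp.
Qed.

End product_measure_sections.

(** * Linear maps and the volume factor *)

Section lebesgueRn_linear.
Context {R : realType} {n : nat}.
Local Notation mu := (lebesgueRn R n).
Local Notation vec := 'cV[R]_n.
Implicit Types (A : 'M[R]_n) (S E : set vec).

(* Tonelli's theorem on the set of the pairs (x, y) with x in S and x + A y in E;
   translation invariance evaluates the sections. *)
Lemma lebesgueRn_linear_swap A S E : A \in unitmx ->
  measurable S -> measurable E ->
  (mu S * mu [set y | E (A *m y)] = mu E * mu [set y | S (- (A *m y))%R])%E.
Proof.
move=> uA mS mE.
have mA := @measurable_mulmx R n n A.
pose W1 := [set p : vec * vec | S p.1 /\ E (p.1 + A *m p.2)].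
pose W2 := [set p : vec * vec | E p.1 /\ S (p.1 - A *m p.2)].
have mW1 : measurable W1.
  apply: measurableI; first exact: (measurable_preimage measurable_fst).
  apply: (measurable_preimage (f := fun p : vec * vec => p.1 + A *m p.2)) => //.
  apply: measurable_col_add; first exact: measurable_fst.
  exact: (measurableT_comp mA measurable_snd).
have mW2 : measurable W2.
  apply: measurableI; first exact: (measurable_preimage measurable_fst).
  apply: (measurable_preimage (f := fun p : vec * vec => p.1 - A *m p.2)) => //.
  apply: measurable_col_add; first exact: measurable_fst.
  under eq_fun do rewrite -mulNmx.
  exact: (measurableT_comp (measurable_mulmx _) measurable_snd).
have mAE : measurable [set y | E (A *m y)] by exact: measurable_preimage.
have mAS : measurable [set y | S (- (A *m y))].
  apply: (measurable_preimage (f := fun y => - (A *m y))) => //.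
  by under eq_fun do rewrite -mulNmx; exact: measurable_mulmx.
transitivity ((mu \x mu)%E W1).
  apply/esym; apply: product_measure1_sections => // x Sx.
    rewrite -(lebesgueRn_shift (invmx A *m x))//; congr (mu _).
    apply/seteqP; split => y /=; rewrite /xsection/= inE/= mulmxDr mulKVmx// addrC//.
    by case.
  by apply/seteqP; split => y //=; rewrite /xsection/= inE/= => -[].
rewrite product_measure12//.
transitivity ((mu \x mu)%E W2); last first.
  apply: product_measure1_sections => // x Ex.
    rewrite -(lebesgueRn_shift (- (invmx A *m x)))//; congr (mu _).
    apply/seteqP; split => y /=;
      rewrite /xsection/= inE/= mulmxDr mulmxN mulKVmx// opprD opprK addrC//.
    by case.
  by apply/seteqP; split => y //=; rewrite /xsection/= inE/= => -[].
(* For fixed y, the substitution x -> x + A y carries the slice of [W1] to that of [W2]. *)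
rewrite product_measure12//; apply: eq_integral => y _ /=.
rewrite -[RHS](lebesgueRn_shift (A *m y)); last exact: measurable_ysection.
congr (mu _); apply/seteqP; split => x /=;
  by rewrite /ysection/= !inE/= /W1 /W2 /= addrK => -[].
Qed.

Definition unit_cube : set vec :=
  [set x : vec | forall i, 0 <= x i ord0 <= 1].

Lemma measurable_box (a b : vec) :
  measurable [set x : vec | forall i, a i ord0 <= x i ord0 <= b i ord0].
Proof.
rewrite (_ : [set _ | _] = \bigcap_(i in [set: 'I_n])
    ((fun x : vec => x i ord0) @^-1` `[a i ord0, b i ord0]%classic)).
  apply: fin_bigcap_measurable => // i _.
  by apply: measurable_preimage => //; exact: measurable_coor.
by apply/seteqP; split=> x /= h i; [move=> _|]; have := h i; rewrite /= in_itv/=; exact.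
Qed.

Lemma measurable_unit_cube : measurable unit_cube.
Proof.
have := measurable_box (const_mx 0) (const_mx 1).
by congr measurable; apply/seteqP; split => x h i; have := h i; rewrite !mxE.
Qed.

Lemma lebesgueRn_unit_cube : mu unit_cube = 1%E.
Proof.
rewrite (_ : unit_cube = [set x : vec | forall i, (const_mx 0 : vec) i ord0
    <= x i ord0 <= (const_mx 1 : vec) i ord0]).
  rewrite lebesgueRn_box; last by move=> i; rewrite !mxE.
  by congr EFin; rewrite big1// => i _; rewrite !mxE subr0.
by apply/seteqP; split => x h i; have := h i; rewrite !mxE.
Qed.

(* |det A|^-1 when A is invertible *)
Definition volume_factor A : \bar R := mu [set y | unit_cube (A *m y)].

(** The unit cube as [E] in the swap identity isolates the measure on the left; the sign, which
    comes from solving x + A y for x, is removed next. *)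
Let lebesgueRn_linearN A S : A \in unitmx -> measurable S ->
  mu [set y | S (- (A *m y))] = (volume_factor A * mu S)%E.
Proof.
move=> uA mS; rewrite muleC (lebesgueRn_linear_swap uA mS measurable_unit_cube).
by rewrite lebesgueRn_unit_cube mul1e.
Qed.

(** The signed identity for the identity matrix shows that reflection preserves the measure; applied
    to the reflected set, the signed identity for [A] then loses its sign. *)
Lemma lebesgueRn_linear A S : A \in unitmx -> measurable S ->
  mu [set y | S (A *m y)] = (volume_factor A * mu S)%E.
Proof.
move=> uA mS.
have mN : measurable [set y | S (- y)].
  apply: (measurable_preimage (f := fun y : vec => - y)) => //.
  by under eq_fun do rewrite -[X in - X]mul1mx -mulNmx; exact: measurable_mulmx.
have -> : mu [set y | S (A *m y)] = mu [set y | [set z | S (- z)] (- (A *m y))].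
  by congr (mu _); apply/seteqP; split => y /=; rewrite opprK.
rewrite lebesgueRn_linearN//; congr (_ * _)%E.
have -> : mu [set y | S (- y)] = mu [set y | S (- (1%:M *m y))].
  by congr (mu _); apply/seteqP; split => y /=; rewrite mul1mx.
rewrite lebesgueRn_linearN ?unitmx1//.
rewrite (_ : volume_factor 1%:M = 1%E) ?mul1e//.
rewrite /volume_factor -lebesgueRn_unit_cube.
by congr (mu _); apply/seteqP; split => y /=; rewrite mul1mx.
Qed.

Lemma volume_factorV A : A \in unitmx -> (volume_factor (invmx A) * volume_factor A = 1)%E.
Proof.
move=> uA; rewrite -lebesgueRn_linear ?unitmx_inv//; last first.
  apply: measurable_preimage; first exact: measurable_mulmx.
  exact: measurable_unit_cube.
rewrite -lebesgueRn_unit_cube.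
by congr (mu _); apply/seteqP; split => y /=; rewrite mulKVmx.
Qed.

(** The factors of [A] and of its inverse multiply to 1; as 0 times [+oo] is 0, neither can be 0 or
    [+oo]. *)
Lemma volume_factor_gt0 A : A \in unitmx -> exists2 c : R, 0 < c & volume_factor A = c%:E.
Proof.
move=> uA; have := volume_factorV uA.
have : (0 <= volume_factor (invmx A))%E by exact: measure_ge0.
have : (0 <= volume_factor A)%E by exact: measure_ge0.
have neq01 : 0%:E = 1%E :> \bar R -> False.
  by move=> /eqP; rewrite eqe eq_sym oner_eq0.
case: (volume_factor A) => [x| |]//; case: (volume_factor (invmx A)) => [y| |]//;
  rewrite ?lee_fin => x0 y0.
- move=> yx; exists x => //; rewrite lt_neqAle x0 andbT; apply/eqP => x00.
  by apply: neq01; rewrite -yx -x00 mule0.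
- move=> yx; exists x => //; rewrite lt_neqAle x0 andbT; apply/eqP => x00.
  by apply: neq01; rewrite -yx -x00 mule0.
- move: y0; rewrite le_eqVlt => /orP[/eqP <-|y0]; first by rewrite mul0e => /neq01.
  by rewrite gt0_muley ?lte_fin.
Qed.

Lemma lebesgueRn_affine (a : vec) A S : A \in unitmx -> measurable S ->
  mu [set y | S (a + A *m y)] = (volume_factor A * mu S)%E.
Proof.
move=> uA mS; rewrite -(lebesgueRn_shift a mS) -lebesgueRn_linear//; last first.
  exact: (measurable_preimage (measurable_col_add (@measurable_id _ _ _) (measurable_cst _))).
by congr (mu _); apply/seteqP; split => y /=; rewrite addrC.
Qed.

Lemma volume_factor_scalar (t : R) : 0 < t -> volume_factor t%:M = ((t^-1) ^+ n)%:E.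
Proof.
move=> t0; rewrite /volume_factor.
rewrite (_ : [set y | _] = [set x : vec | forall i, (const_mx 0 : vec) i ord0
    <= x i ord0 <= (const_mx t^-1 : vec) i ord0]).
  rewrite lebesgueRn_box; last by move=> i; rewrite !mxE invr_ge0 ltW.
  congr EFin; rewrite (eq_bigr (fun=> t^-1)) ?prodr_const ?card_ord//.
  by move=> i _; rewrite !mxE subr0.
apply/seteqP; split => x h i; have := h i.
  by rewrite mul_scalar_mx !mxE pmulr_rge0// mulrC -ler_pdivlMr// mul1r.
by rewrite mul_scalar_mx !mxE pmulr_rge0// mulrC -ler_pdivlMr// mul1r.
Qed.

Lemma enormZ (t : R) (x : vec) : enorm (t *: x) = `|t| * enorm x.
Proof.
rewrite /enorm (eq_bigr (fun i => t ^+ 2 * x i ord0 ^+ 2)); last first.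
  by move=> i _; rewrite mxE exprMn.
by rewrite -mulr_sumr sqrtrM ?sqr_ge0// sqrtr_sqr.
Qed.

Lemma enorm_ge0 (x : vec) : 0 <= enorm x.
Proof. exact: sqrtr_ge0. Qed.

Lemma enorm_sqr (x : vec) : enorm x ^+ 2 = \sum_(i < n) x i ord0 ^+ 2.
Proof. by rewrite sqr_sqrtr// sumr_ge0// => i _; exact: sqr_ge0. Qed.

Lemma coor_le_enorm (x : vec) i : `|x i ord0| <= enorm x.
Proof.
rewrite -sqrtr_sqr ler_wsqrtr// (bigD1 i)//= lerDl sumr_ge0// => j _.
exact: sqr_ge0.
Qed.

(** The closed Euclidean unit ball, written without the root so that it is a sublevel set of a
    visibly measurable function. *)
Let U : set vec := [set x | \sum_(i < n) x i ord0 ^+ 2 <= 1].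

Let UE : U = [set x | enorm x <= 1].
Proof.
apply/seteqP; split => x; rewrite /U/= -(enorm_sqr x).
  by rewrite -[X in _ <= X](expr1n _ 2) ler_sqr ?nnegrE ?enorm_ge0.
by rewrite -[X in _ -> _ <= X](expr1n _ 2) ler_sqr ?nnegrE ?enorm_ge0.
Qed.

Let mU : measurable U.
Proof.
rewrite (_ : U = (fun x : vec => \sum_(i < n) x i ord0 ^+ 2) @^-1` `]-oo, 1]%classic).
  apply: measurable_preimage => //; apply: measurable_sum => i.
  by apply: measurable_funX; exact: measurable_coor.
by apply/seteqP; split => x /=; rewrite in_itv.
Qed.

Let muU_gt0 : (0 < n)%N -> (0 < mu U)%E.
Proof.
move=> n0.
have nR : 0 < n%:R :> R by rewrite ltr0n.
(* Coordinates in [0, 1/n] satisfy x_i^2 <= x_i <= 1/n, so the n squares sum to at most 1. *)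
pose Q := [set x : vec | forall i, (const_mx 0 : vec) i ord0
    <= x i ord0 <= (const_mx n%:R^-1 : vec) i ord0].
have QU : Q `<=` U.
  move=> x Qx; rewrite /U/=.
  apply: (@le_trans _ _ (\sum_(i < n) n%:R^-1)); last first.
    by rewrite sumr_const card_ord -[_ *+ _]mulr_natr mulVf ?gt_eqF.
  apply: ler_sum => i _; have := Qx i; rewrite !mxE => /andP[x0 xn].
  rewrite expr2; apply: le_trans xn; rewrite ler_piMr//.
  apply: le_trans (_ : n%:R^-1 <= 1); last by rewrite invf_le1// ler1n.
  by have := Qx i; rewrite !mxE => /andP[].
apply: (@lt_le_trans _ _ (mu Q)); last first.
  by apply: le_measure => //; rewrite inE; [exact: measurable_box|exact: mU].
rewrite /Q lebesgueRn_box; last by move=> i; rewrite !mxE invr_ge0 ltW.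
by rewrite lte_fin prodr_gt0// => i _; rewrite !mxE subr0 invr_gt0.
Qed.

Let muU_fin : (mu U < +oo)%E.
Proof.
pose Q := [set x : vec | forall i, (const_mx (-1) : vec) i ord0
    <= x i ord0 <= (const_mx 1 : vec) i ord0].
have QU : U `<=` Q.
  move=> x; rewrite UE /= => x1 i; rewrite !mxE -ler_norml.
  exact: le_trans (coor_le_enorm _ _) x1.
apply: (@le_lt_trans _ _ (mu Q)).
  by apply: le_measure => //; rewrite inE; [exact: mU|exact: measurable_box].
by rewrite /Q lebesgueRn_box ?ltry// => i; rewrite !mxE; lra.
Qed.

(* The preimage of the unit ball under A is contained in the ball of radius b. *)
Lemma volume_factor_le A (b : R) : (0 < n)%N -> A \in unitmx -> 0 < b ->
  (forall x : vec, enorm (invmx A *m x) <= b * enorm x) ->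
  (volume_factor A <= (b ^+ n)%:E)%E.
Proof.
move=> n0 uA b0 hb.
have U0 := muU_gt0 n0.
have Ufin : mu U \is a fin_num by rewrite ge0_fin_numE.
(* The ball has positive finite measure, and b^n is the volume factor of b^-1 times the identity.
   Both sides thus become measures of preimages of the ball, which are compared by inclusion. *)
rewrite -(@lee_pmul2r _ (mu U))//.
have bE : (b ^+ n)%:E = volume_factor (b^-1)%:M by rewrite volume_factor_scalar ?invr_gt0// invrK.
have ub : ((b^-1)%:M : 'M[R]_n) \in unitmx.
  by rewrite unitmxE det_scalar unitrX// unitfE invr_eq0 gt_eqF.
rewrite bE -!lebesgueRn_linear//.
apply: le_measure; rewrite ?inE.
- by apply: measurable_preimage => //; exact: measurable_mulmx.
- by apply: measurable_preimage => //; exact: measurable_mulmx.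
move=> y; rewrite UE /= mul_scalar_mx enormZ gtr0_norm ?invr_gt0// => Ay.
rewrite ler_pdivrMl// mulr1 -(mulKmx uA y).
by apply: le_trans (hb _) _; rewrite ler_piMr// ltW.
Qed.

End lebesgueRn_linear.

(** * Measurability of open sets and of continuous functions *)

Section borel.
Context {R : realType} {n : nat}.
Local Notation vec := 'cV[R]_n.

(** The sigma-algebra is generated by the coordinates. An open set is the union of the closed boxes
    with rational centre and radius 1/(k+1) that it contains, and there are countably many of
    them. *)
Lemma open_measurable_col (U : set vec) : open U -> measurable U.
Proof.
move=> oU.
pose bx (p : 'cV[rat]_n * nat) := [set x : vec | forall i,
  (\col_i (ratr (p.1 i ord0) - p.2.+1%:R^-1) : vec) i ord0 <= x i ord0
    <= (\col_i (ratr (p.1 i ord0) + p.2.+1%:R^-1) : vec) i ord0].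
pose F p := if pselect (bx p `<=` U) then bx p else set0.
rewrite (_ : U = \bigcup_p F p); last first.
  apply/seteqP; split => [x Ux|x [p _]]; last first.
    by rewrite /F; case: pselect => // s; exact: s.
  have /nbhs_ballP[e /= e0 eU] : nbhs x U by exact: open_nbhs_nbhs.
  (* A centre within d of x and a box of radius d give distances below 2 d < e, so the box stays in
     the ball around x. *)
  have [k [d dE [d0 de]]] : exists k : nat, exists2 d : R,
      k.+1%:R^-1 = d & 0 < d /\ d < e / 2.
    have [k _ /(_ k (leqnn k)) kP] :=
      near_infty_natSinv_lt (PosNum (divr_gt0 e0 (ltr0Sn R 1))).
    by exists k, k.+1%:R^-1 => //; rewrite invr_gt0.
  have /choice[q qP] : forall i : 'I_n, exists q : rat,
      x i ord0 - d < ratr q < x i ord0 + d.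
    move=> i; have [|q] := @rat_in_itvoo R (x i ord0 - d) (x i ord0 + d).
      by lra.
    by rewrite in_itv/=; exists q.
  pose p : 'cV[rat]_n * nat := (\col_i q i, k).
  have bU : bx p `<=` U.
    move=> y by_; apply: eU; split => // i j; rewrite ord1 -ball_normE /=.
    have := by_ i; rewrite /p /= !mxE dE; have := qP i.
    move=> /andP[? ?] /andP[? ?]; rewrite ltr_norml; apply/andP; split; lra.
  exists p => //; rewrite /F; case: pselect => // _ i.
  rewrite /p /= !mxE dE; have := qP i.
  by move=> /andP[u1 u2]; apply/andP; split; lra.
apply: countable_bigcupT_measurable => // p; rewrite /F; case: pselect => [s|s] /=; last exact: measurable0.
exact: measurable_box.
Qed.

Lemma continuous_measurable_col (f : vec -> R) :
  continuous f -> measurable_fun setT f.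
Proof.
move=> /continuousP cf; apply: (measurability _ (RGenOpens.measurableE R)).
move=> _ [_ [a [b ->] <-]]; rewrite setTI; apply: open_measurable_col.
exact/cf/interval_open.
Qed.

End borel.

(** * Derivatives of functions with continuous partial derivatives *)

Section directional_derivatives.
Context {R : realType} {V : normedModType R}.
Implicit Types (f : V -> R) (u w x y : V).

Lemma is_derive_line f w y (t : R) : derivable f (t *: w + y) w ->
  is_derive t 1 (fun t : R => f (t *: w + y)) ('D_w f (t *: w + y)).
Proof.
move=> df.
have E : (fun h : R => h^-1 *: (((fun t => f (t *: w + y)) \o shift t) (h *: 1)
    - f (t *: w + y))) =
  (fun h : R => h^-1 *: ((f \o shift (t *: w + y)) (h *: w) - f (t *: w + y))).
  by apply/funext => h; rewrite /= [h%:A]mulr1 scalerDl addrA.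
by apply: DeriveDef; rewrite /derivable /derive E.
Qed.

Lemma MVT_line f w y (h : R) : (forall x, derivable f x w) ->
  exists2 c : R, `|c| <= `|h| &
    f (h *: w + y) - f y = 'D_w f (c *: w + y) * h.
Proof.
move=> df; pose g (t : R) := f (t *: w + y).
have dg (t : R) : is_derive t 1 g ('D_w f (t *: w + y)) by exact: is_derive_line.
have cg (i : interval R) : {within [set` i], continuous g}.
  by apply: derivable_within_continuous => t _; exact: (@ex_derive _ _ _ _ _ _ _ (dg t)).
have [h0|h0] := leP 0 h.
  have [c] := MVT_segment h0 (fun t _ => dg t) (cg _).
  rewrite in_itv/= => /andP[c0 ch]; rewrite /g scale0r add0r subr0 => E.
  by exists c => //; rewrite !ger0_norm.
have [c] := MVT_segment (ltW h0) (fun t _ => dg t) (cg _).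
rewrite in_itv/= => /andP[c0 ch]; rewrite /g scale0r add0r sub0r => E.
exists c; first by rewrite !ler0_norm ?lerN2// ltW.
by rewrite -opprB E mulrN opprK.
Qed.

(** The increment along u + w is split at x + h u. The first part is the difference quotient along
    u; by the mean value theorem the second is the derivative along w at a point near x, which
    converges by continuity. *)
Lemma is_derive_dirD f u w x : (forall x, derivable f x u) ->
  (forall x, derivable f x w) -> continuous (fun x => 'D_w f x) ->
  is_derive x (u + w) f ('D_u f x + 'D_w f x).
Proof.
move=> dfu dfw cw.
suff H : (fun h : R => h^-1 *: ((f \o shift x) (h *: (u + w)) - f x)) @ 0^' -->
    'D_u f x + 'D_w f x.
  by apply: DeriveDef; [apply/cvg_ex; eexists; exact: H|exact: cvg_lim].
pose q (h : R) := h^-1 *: (f (h *: w + (h *: u + x)) - f (h *: u + x)).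
rewrite (_ : (fun h => _) =
  (fun h : R => h^-1 *: ((f \o shift x) (h *: u) - f x) + q h)); last first.
  apply/funext => h; rewrite /q /= -scalerDr; congr (_ *: _).
  by rewrite scalerDr [h *: w + (_ + _)]addrCA addrA [RHS]addrC subrKA.
apply: cvgD; first exact: dfu.
apply/cvgrPdist_lt => e e0.
have /cvgrPdist_lt/(_ e e0)/nbhs_ballP[d /= d0 dP] := cw x.
(* The intermediate point is at distance at most |h| (|u| + |w|) from x; the summand 1 makes [M]
   positive. *)
pose M : R := `|u| + `|w| + 1.
have M0 : 0 < M by rewrite /M; apply: ltr_wpDl => //; exact: addr_ge0.
near=> h.
have h0 : h != 0 by near: h; exact: nbhs_dnbhs_neq.
have hd : `|h| < d / M by near: h; apply: dnbhs0_lt; exact: divr_gt0.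
rewrite /q; have [c ch ->] := MVT_line (h *: u + x) h dfw.
rewrite [_ *: _]mulrC mulfK//; apply: dP.
rewrite -ball_normE /= distrC addrA addrK.
apply: le_lt_trans (ler_normD _ _) _; rewrite !normrZ.
apply: (@le_lt_trans _ _ (`|h| * M)); last by rewrite -ltr_pdivlMr.
rewrite /M !mulrDr mulr1.
have := ler_wpM2r (normr_ge0 w) ch.
have := normr_ge0 h.
by move: (`|c| * `|w|) (`|h| * `|w|) (`|h| * `|u|) `|h| => *; lra.
Unshelve. all: by end_near. Qed.

(** The one-variable chain rule for t -> a t on the line through x, which includes a = 0. *)
Lemma is_derive_dirZ f w x (a : R) : derivable f x w ->
  is_derive x (a *: w) f (a * 'D_w f x).
Proof.
move=> df; pose g (t : R) := f (t *: w + x).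
have dg : is_derive (0 : R) 1 g ('D_w f x).
  by have := @is_derive_line f w x 0; rewrite scale0r add0r => /(_ df).
have ga : is_derive (0 : R) 1 (g \o ( *%R a)) ('D_w f x * a).
  apply: is_derive1_comp; first by rewrite mulr0.
  have := is_deriveZ a (is_derive_id (0 : R) 1).
  by rewrite [_%:A]mulr1.
have E : (fun h : R => f (h *: (a *: w) + x)) = g \o ( *%R a).
  by apply/funext => h; rewrite /g /= scalerA mulrC.
apply: DeriveDef.
  by apply/derivable1P; rewrite E; case: ga.
have E' : (fun h : R => h^-1 *: ((f \o shift x) (h *: (a *: w)) - f x)) =
    (fun h : R => h^-1 *: (((g \o ( *%R a)) \o shift 0) (h *: 1) - (g \o ( *%R a)) 0)).
  apply/funext => h; rewrite /= /g mulr0 scale0r add0r addr0 [h%:A]mulr1.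
  by rewrite scalerA mulrC.
by rewrite mulrC -(@derive_val _ _ _ _ _ _ _ ga) /derive E'.
Qed.

End directional_derivatives.

Section partial_derivatives.
Context {R : realType} {n : nat}.
Local Notation vec := 'cV[R]_n.
Local Notation e i := (delta_mx i ord0 : vec).
Implicit Types (f g : vec -> R).

(** The direction is built up one coordinate at a time; each new summand w_i e_i takes the place of
    the direction along which the derivative is continuous. *)
Lemma is_derive_partials f (w x : vec) :
  (forall i x, derivable f x (e i)) -> (forall i, continuous (partial i f)) ->
  is_derive x w f (\sum_(i < n) w i ord0 * partial i f x).
Proof.
move=> df cf.
have sumP (r : seq 'I_n) : forall x, is_derive x (\sum_(i <- r) w i ord0 *: (e i)) f
    (\sum_(i <- r) w i ord0 * partial i f x).
  elim: r => [|i r IH] y.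
    rewrite !big_nil; apply: DeriveDef; first exact: derivable0.
    by rewrite derive0.
  rewrite !big_cons addrC [X in is_derive _ _ _ X]addrC.
  have dZ z := is_derive_dirZ (w i ord0) (df i z).
  have E z : 'D_(w i ord0 *: (e i)) f z = w i ord0 * partial i f z.
    by apply: derive_val; exact: dZ.
  rewrite -E -(@derive_val _ _ _ _ _ _ _ (IH y)).
  apply: is_derive_dirD.
  - by move=> z; case: (IH z).
  - by move=> z; case: (dZ z).
  - rewrite (_ : (fun x => _) = (fun z => w i ord0 * partial i f z)); last exact/funext.
    by move=> z; exact: (cvgM (cvg_cst _) (cf i z)).
have := sumP (index_enum 'I_n) x.
rewrite (_ : \sum_(i <- _) w i ord0 *: (e i) = w)//.
apply/colP => k; rewrite summxE (bigD1 k)//= big1 ?addr0 => [|i ik]; rewrite !mxE.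
  by rewrite !eqxx mulr1.
by rewrite eq_sym (negbTE ik) mulr0.
Qed.

Lemma is_Ck_continuous k f : is_Ck k f -> continuous f.
Proof. by case: k => [|k] []. Qed.

Lemma is_Ck_cst0 k : is_Ck k (fun _ : vec => 0 : R).
Proof.
have c0 : continuous (fun _ : vec => 0 : R) by exact: cst_continuous.
elim: k => [|k IH]; first by split.
split=> //; split=> [i x|i]; first exact: (derivable_cst (0 : R)).
rewrite (_ : partial i _ = fun=> 0)//.
by apply/funext => x; exact: derive_cst.
Qed.

Lemma is_Ck_scaleD k (c : R) f g : is_Ck k f -> is_Ck k g ->
  is_Ck k (fun x => c * f x + g x).
Proof.
elim: k f g => [|k IH] f g [cf kf] [cg kg].
  by split=> // x; apply: cvgD (cg x); apply: cvgM (cf x); exact: cvg_cst.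
split; first by move=> x; apply: cvgD (cg x); apply: cvgM (cf x); exact: cvg_cst.
case: kf kg => [df kf] [dg kg].
have E : (fun x => c * f x + g x) = (c \*: f) + g by [].
split=> [i x|i].
  by rewrite E; apply: derivableD => //; exact: derivableZ.
rewrite (_ : partial i _ = fun x => c * partial i f x + partial i g x).
  by apply: IH; [exact: kf|exact: kg].
by apply/funext => x; rewrite /partial E deriveD ?deriveZ//; exact: derivableZ.
Qed.

Lemma is_Ck_lin k (I : Type) (r : seq I) (c : I -> R) (f : I -> vec -> R) :
  (forall i, is_Ck k (f i)) -> is_Ck k (fun x => \sum_(i <- r) c i * f i x).
Proof.
move=> kf; elim: r => [|i r IH].
  by under eq_fun do rewrite big_nil; exact: is_Ck_cst0.
by under eq_fun do rewrite big_cons; exact: is_Ck_scaleD.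
Qed.

Lemma continuous_col (T : topologicalType) (m : nat) (f : T -> 'cV[R]_m) :
  (forall i, continuous (fun x => f x i ord0)) -> continuous f.
Proof.
move=> cf x S [P Pf PS].
have H : \forall y \near x, forall i : 'I_m, P i ord0 (f y i ord0).
  by apply: filter_forall => i; exact: (cf i x _ (Pf i ord0)).
by apply: filterS H => y Py; apply: PS => i j; rewrite ord1.
Qed.

Lemma continuous_affine m (a : 'cV[R]_m) (A : 'M[R]_(m, n)) :
  continuous (fun x : vec => a + A *m x).
Proof.
apply: continuous_col => i; under eq_fun do rewrite !mxE.
have cm j : continuous (fun x : vec => A i j * x j ord0).
  by move=> x; apply: continuousM; [exact: cst_continuous|exact: coord_continuous].
have cs (r : seq 'I_n) : continuous (fun x : vec => \sum_(j <- r) A i j * x j ord0).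
  elim: r => [|j r IH].
    by under eq_fun do rewrite big_nil; exact: cst_continuous.
  rewrite (_ : (fun _ => _) =
    (fun x : vec => A i j * x j ord0 + \sum_(j <- r) A i j * x j ord0)).
    by move=> x; exact: (continuousD (cm j x) (IH x)).
  by apply/funext => x; rewrite big_cons.
by move=> x; exact: (continuousD (@cst_continuous _ _ (a i ord0) x) (cs _ x)).
Qed.

Lemma continuous_comp_affine f (a : vec) (A : 'M[R]_n) :
  continuous f -> continuous (fun x => f (a + A *m x)).
Proof.
move=> cf x; apply: (@continuous_comp _ _ _ (fun x : vec => a + A *m x) f).
  exact: continuous_affine.
exact: cf.
Qed.

Lemma is_derive_affine f (a : vec) (A : 'M[R]_n) (x : vec) j :
  (forall i x, derivable f x (e i)) -> (forall i, continuous (partial i f)) ->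
  is_derive x (e j) (fun x => f (a + A *m x))
    (\sum_(i < n) A i j * partial i f (a + A *m x)).
Proof.
move=> df cf; have := is_derive_partials (A *m (e j)) (a + A *m x) df cf.
rewrite (eq_bigr (fun i => A i j * partial i f (a + A *m x))); last first.
  by move=> i _; rewrite -colE mxE.
move=> [d1 d2].
have E : (fun h : R => h^-1 *: (((fun x => f (a + A *m x)) \o shift x) (h *: (e j))
    - f (a + A *m x))) =
  (fun h : R => h^-1 *: ((f \o shift (a + A *m x)) (h *: (A *m (e j)))
    - f (a + A *m x))).
  by apply/funext => h; rewrite /= mulmxDr -scalemxAr addrCA.
by apply: DeriveDef; rewrite /derivable /derive E.
Qed.

(** By the chain rule the partial derivatives are constant linear combinations of partial
    derivatives of [f] composed with the same affine map, so the induction applies to each of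
    them. *)
Lemma is_Ck_affine k f (a : vec) (A : 'M[R]_n) :
  is_Ck k f -> is_Ck k (fun x => f (a + A *m x)).
Proof.
elim: k f => [|k IH] f [cf kf].
  by split=> //; exact: continuous_comp_affine.
split; first exact: continuous_comp_affine.
case: kf => [df kf].
have cp i : continuous (partial i f) by exact: is_Ck_continuous (kf i).
have H x j := is_derive_affine a A x j df cp.
split=> [j x|j]; first by case: (H x j).
rewrite (_ : partial j _ = fun x => \sum_(i < n) A i j * partial i f (a + A *m x)).
  by apply: is_Ck_lin => i; apply: IH; exact: kf.
by apply/funext => x; by case: (H x j).
Qed.

End partial_derivatives.

(** * Euclidean norm and L2 functions *)

Section euclidean_norm.
Context {R : realType} {n : nat}.
Local Notation vec := 'cV[R]_n.
Implicit Types (x y : vec).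

Lemma enorm0 : enorm (0 : vec) = 0.
Proof. by rewrite -(scale0r 0) enormZ normr0 mul0r. Qed.

Lemma enormN x : enorm (- x) = enorm x.
Proof. by rewrite -scaleN1r enormZ normrN1 mul1r. Qed.

Lemma enorm_eq0 x : enorm x = 0 -> x = 0.
Proof.
move=> x0; apply/colP => i; rewrite mxE; apply/eqP; rewrite -normr_le0 -x0.
exact: coor_le_enorm.
Qed.

(** Expanding the squared norm of |y| x - |x| y gives 2 |x| |y| (|x| |y| - <x, y>), which is
    therefore nonnegative. *)
Lemma Cauchy_Schwarz x y :
  \sum_(i < n) x i ord0 * y i ord0 <= enorm x * enorm y.
Proof.
have [x0|x0] := eqVneq (enorm x) 0.
  by rewrite (enorm_eq0 x0) enorm0 mul0r big1// => i _; rewrite mxE mul0r.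
have [y0|y0] := eqVneq (enorm y) 0.
  by rewrite (enorm_eq0 y0) enorm0 mulr0 big1// => i _; rewrite mxE mulr0.
have xp : 0 < enorm x by rewrite lt_neqAle eq_sym x0 enorm_ge0.
have yp : 0 < enorm y by rewrite lt_neqAle eq_sym y0 enorm_ge0.
have sum0 : 0 <= \sum_(i < n) (enorm y * x i ord0 - enorm x * y i ord0) ^+ 2.
  by apply: sumr_ge0 => i _; exact: sqr_ge0.
suff E : \sum_(i < n) (enorm y * x i ord0 - enorm x * y i ord0) ^+ 2 =
    2 * (enorm x * enorm y) * (enorm x * enorm y - \sum_(i < n) x i ord0 * y i ord0).
  by move: sum0; rewrite E pmulr_rge0 ?subr_ge0// !mulr_gt0.
rewrite (eq_bigr (fun i => enorm y ^+ 2 * x i ord0 ^+ 2 + enorm x ^+ 2 * y i ord0 ^+ 2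
   - 2 * (enorm x * enorm y) * (x i ord0 * y i ord0))); last by move=> i _; ring.
by rewrite sumrB big_split/= -!mulr_sumr -!enorm_sqr; ring.
Qed.

Lemma ler_enormD x y : enorm (x + y) <= enorm x + enorm y.
Proof.
rewrite -ler_sqr ?nnegrE ?addr_ge0 ?enorm_ge0// enorm_sqr.
rewrite (eq_bigr (fun i => x i ord0 ^+ 2 + 2 * (x i ord0 * y i ord0) + y i ord0 ^+ 2));
  last by move=> i _; rewrite mxE; ring.
rewrite !big_split/= -mulr_sumr -!enorm_sqr.
by have := Cauchy_Schwarz x y; nra.
Qed.

(** From |A^T x|^2 = <x, A A^T x> <= |x| b |A^T x|. It is needed because gradients are pulled back
    by the transpose. *)
Lemma enorm_tr_le (A : 'M[R]_n) (b : R) : 0 <= b ->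
  (forall x, enorm (A *m x) <= b * enorm x) ->
  forall x, enorm (A^T *m x) <= b * enorm x.
Proof.
move=> b0 hA x; have [/eqP x0|x0] := boolP (enorm (A^T *m x) == 0).
  by rewrite x0 mulr_ge0// enorm_ge0.
have xp : 0 < enorm (A^T *m x) by rewrite lt_neqAle eq_sym x0 enorm_ge0.
rewrite -(ler_pM2r xp) -expr2.
have -> : enorm (A^T *m x) ^+ 2 = \sum_(i < n) x i ord0 * (A *m (A^T *m x)) i ord0.
  rewrite enorm_sqr.
  under [RHS]eq_bigr do rewrite mxE mulr_sumr.
  rewrite exchange_big/=; apply: eq_bigr => j _.
  rewrite expr2 {1}mxE mulr_suml; apply: eq_bigr => i _.
  by rewrite mxE; ring.
apply: le_trans (Cauchy_Schwarz _ _) _.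
by rewrite [b * _]mulrC -mulrA ler_wpM2l// enorm_ge0.
Qed.

Lemma enorm_le_sum x : enorm x <= \sum_(i < n) `|x i ord0|.
Proof.
rewrite -ler_sqr ?nnegrE ?enorm_ge0 ?sumr_ge0// enorm_sqr.
rewrite [leRHS]expr2 mulr_suml; apply: ler_sum => i _.
rewrite -[x i ord0 ^+ 2]ger0_norm ?sqr_ge0// normrX expr2 ler_wpM2l//.
by rewrite (bigD1 i)//= lerDl sumr_ge0.
Qed.

Lemma coor_le_norm x i : `|x i ord0| <= `|x|.
Proof.
rewrite [leRHS]/Num.Def.normr/= mx_normrE.
exact: (le_bigmax _ (fun ij : 'I_n * 'I_1 => `|x ij.1 ij.2|) (i, ord0)).
Qed.

Lemma norm_le_enorm x : `|x| <= enorm x.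
Proof.
rewrite [leLHS]/Num.Def.normr/= mx_normrE (bigmax_le _ (enorm_ge0 x))//= => -[i j] _.
by rewrite ord1; exact: coor_le_enorm.
Qed.

Lemma enorm_le_norm x : enorm x <= n%:R * `|x|.
Proof.
apply: le_trans (enorm_le_sum x) _.
apply: (@le_trans _ _ (\sum_(i < n) `|x|)).
  by apply: ler_sum => i _; exact: coor_le_norm.
by rewrite sumr_const card_ord mulr_natl.
Qed.

End euclidean_norm.

(** * Square-integrable functions and test functions *)

Section L2.
Context {R : realType} {n : nat}.
Local Notation vec := 'cV[R]_n.
Local Notation mu := (lebesgueRn R n).
Implicit Types (O : set vec) (v f phi : vec -> R).

Lemma l2norm_ge0 O f : (0 <= l2norm O f)%E.
Proof. exact: sqrte_ge0. Qed.

Lemma l2norm_sqr O f : (l2norm O f ^+ 2 = \int[mu]_(x in O) (`|f x| ^+ 2)%:E)%E.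
Proof.
by rewrite /l2norm sqr_sqrte// integral_ge0// => x _; rewrite lee_fin sqr_ge0.
Qed.

Lemma expe2_lty (x : \bar R) : (0 <= x)%E -> (x ^+ 2 < +oo)%E = (x < +oo)%E.
Proof. by case: x => [r| |]//= _; rewrite [RHS]ltry; exact: ltry. Qed.

Lemma bounded_measure_fin O : measurable O -> bounded_set O -> (mu O < +oo)%E.
Proof.
move=> mO [M [Mr hM]]; pose N := `|M| + 1.
have N0 : 0 <= N by rewrite /N addr_ge0.
have hN x : O x -> `|x| <= N.
  by apply: hM; rewrite /N; apply: le_lt_trans (ler_norm M) _; rewrite ltrDl.
apply: (@le_lt_trans _ _ (mu [set x : vec | forall i, (const_mx (- N) : vec) i ord0
    <= x i ord0 <= (const_mx N : vec) i ord0])).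
  apply: le_measure; rewrite ?inE//; first exact: measurable_box.
  move=> x Ox i; rewrite !mxE -ler_norml.
  exact: le_trans (coor_le_norm _ _) (hN _ Ox).
by rewrite lebesgueRn_box ?ltry// => i; rewrite !mxE; lra.
Qed.

(** Since |v| <= 1 + |v|^2, the product is dominated by (M + 1)(1 + |v|^2), integrable on a set of
    finite measure; M + 1 is positive even if M is 0. This makes the integrals in the weak gradient
    identity additive. *)
Lemma integrable_L2_bounded O v phi (M : R) : open O -> bounded_set O ->
  in_L2 O v -> continuous phi -> (forall x, `|phi x| <= M) ->
  mu.-integrable O (fun x => (v x * phi x)%:E).
Proof.
move=> oO bO [mv lv] cphi phiM.
have mO := open_measurable_col oO.
have mphi : measurable_fun O phi.
  exact: measurable_funTS (continuous_measurable_col cphi).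
apply/integrableP; split.
  by apply/measurable_EFinP; exact: measurable_funM.
have M1 : 0 < M + 1.
  by have := phiM 0; have := normr_ge0 (phi 0); lra.
apply: (@le_lt_trans _ _ (\int[mu]_(x in O) ((M + 1)%:E * (1%:E + (`|v x| ^+ 2)%:E)))%E).
  apply: le_ge0_integral => x Ox; first exact: abse_ge0.
  rewrite /= -EFinD -EFinM lee_fin normrM.
  have := phiM x; have := normr_ge0 (v x); have := normr_ge0 (phi x).
  move: `|v x| `|phi x| => a b b0 a0 bM.
  have : a <= 1 + a ^+ 2 by nra.
  by nra.
rewrite ge0_integralZ//; last by move=> x _; rewrite -EFinD lee_fin addr_ge0// sqr_ge0.
rewrite ge0_integralD//; last first.
- by apply/measurable_EFinP; apply: measurable_funX; exact: measurableT_comp.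
rewrite integral_cst// mul1e -l2norm_sqr.
rewrite lte_mul_pinfty// ?lee_fin ?ltW//.
by rewrite lte_add_pinfty ?bounded_measure_fin ?expe2_lty ?l2norm_ge0.
Qed.

Lemma integral_lin O (I : finType) (a : I -> R) (f : I -> vec -> R) : measurable O ->
  (forall i, mu.-integrable O (EFin \o f i)) ->
  (\int[mu]_(x in O) (\sum_i a i * f i x)%:E =
   (\sum_i a i * fine (\int[mu]_(x in O) (f i x)%:E))%:E)%E.
Proof.
move=> mO fi.
under eq_integral do rewrite -sumEFin.
rewrite integral_sum//; last by move=> i; exact: (integrableZl mO (a i) (fi i)).
rewrite -sumEFin; apply: eq_bigr => i _.
under eq_integral do rewrite EFinM.
rewrite integralZl//; last exact: fi.
by rewrite EFinM fineK//; apply: integrable_fin_num => //; exact: fi.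
Qed.

Lemma vanishing_bounded (K : set vec) (psi : vec -> R) : compact K ->
  continuous psi -> (forall x, ~ K x -> psi x = 0) ->
  exists M : R, forall x, `|psi x| <= M.
Proof.
move=> cK cpsi psi0.
have [M [_ hM]] : bounded_set (psi @` K).
  apply: compact_bounded; apply: continuous_compact => //.
  exact: continuous_subspaceT.
exists (`|M| + 1) => x.
have [Kx|/psi0 ->] := pselect (K x); last by rewrite normr0 addr_ge0.
apply: (hM (`|M| + 1)); last by exists x.
by apply: le_lt_trans (ler_norm M) _; rewrite ltrDl.
Qed.

Lemma test_function_bounded O phi : test_function O phi ->
  exists M : R, forall x, `|phi x| <= M.
Proof.
move=> [sphi [K [cK _ phi0]]].
by apply: (vanishing_bounded cK) => //; exact: is_Ck_continuous (sphi 0).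
Qed.

(** The complement of the compact set is open, so [phi] is locally zero there and its partial
    derivatives vanish off the same set. *)
Lemma test_function_partial_bounded O phi i : test_function O phi ->
  exists M : R, forall x, `|partial i phi x| <= M.
Proof.
move=> [sphi [K [cK _ phi0]]]; apply: (vanishing_bounded cK).
  by case: (sphi 1%N) => _ [_ /(_ i)[]].
move=> x Kx; rewrite /partial (@near_eq_derive _ _ _ phi (cst 0)).
  exact: derive_cst.
have oK : open (~` K).
  by apply: closed_openC; apply: compact_closed => //; exact: norm_hausdorff.
have : nbhs x (~` K) by exact: open_nbhs_nbhs.
by apply: filterS => y /phi0.
Qed.

End L2.

(** * Pullback of Sobolev and interpolation norms *)

Lemma affineK (R : realType) n (a : 'cV[R]_n) (A : 'M[R]_n) : A \in unitmx ->
  cancel (fun x => a + A *m x) (fun y => - (invmx A *m a) + invmx A *m y).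
Proof. by move=> uA x; rewrite mulmxDr mulKmx// addKr. Qed.

Lemma affineVK (R : realType) n (a : 'cV[R]_n) (A : 'M[R]_n) : A \in unitmx ->
  cancel (fun y => - (invmx A *m a) + invmx A *m y) (fun x => a + A *m x).
Proof. by move=> uA x; rewrite mulmxDr mulmxN !mulKVmx// addrA subrr add0r. Qed.

Section affine_pullback.
Context {R : realType} {n : nat}.
Local Notation vec := 'cV[R]_n.
Local Notation mu := (lebesgueRn R n).
Variables (a : vec) (A : 'M[R]_n) (O : set vec) (b c : R).
Hypotheses (uA : A \in unitmx) (oO : open O) (bO : bounded_set O).
Hypotheses (b0 : 0 < b) (hb : forall x : vec, enorm (A *m x) <= b * enorm x).
Hypotheses (c0 : 0 < c) (hc : volume_factor A = c%:E).
Local Notation G := (fun x : vec => a + A *m x).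
Local Notation H := (fun y : vec => - (invmx A *m a) + invmx A *m y).
Local Notation O' := (G @^-1` O).
Implicit Types (v f phi : vec -> R) (g : vec -> vec).

Let mO : measurable O. Proof. exact: open_measurable_col. Qed.

Let mO' : measurable O'.
Proof. by apply: measurable_preimage => //; exact: measurable_affine. Qed.

Lemma integral_affine (D : set vec) (f : vec -> \bar R) :
  (\int[mu]_(x in G @^-1` D) f (a + A *m x)%R = c%:E * \int[mu]_(y in D) f y)%E.
Proof.
apply: (integral_comp_bij (measurable_affine a A) (measurable_affine _ (invmx A))
  (affineK a uA) (affineVK a uA) c0) => S mS.
by rewrite -hc -(lebesgueRn_affine a).
Qed.

Lemma l2norm_affine f : (l2norm O' (f \o G) ^+ 2 = c%:E * l2norm O f ^+ 2)%E.
Proof.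
by rewrite !l2norm_sqr (integral_affine O (fun x => (`|f x| ^+ 2)%:E)).
Qed.

Lemma in_L2_affine f : in_L2 O f -> in_L2 O' (f \o G).
Proof.
move=> [mf lf]; split.
  apply: (measurable_comp mO _ mf); first by move=> _ [x Ox <-].
  exact: measurable_funTS (measurable_affine a A).
rewrite -expe2_lty ?l2norm_ge0// l2norm_affine.
by rewrite lte_mul_pinfty ?lee_fin ?(ltW b0) ?(ltW c0)// expe2_lty ?l2norm_ge0.
Qed.

Lemma test_function_affine_inv phi :
  test_function O' phi -> test_function O (phi \o H).
Proof.
move=> [sphi [K [cK KO phi0]]]; split.
  by move=> k; exact: is_Ck_affine (sphi k).
exists (G @` K); split.
- apply: continuous_compact => //; apply: continuous_subspaceT.
  exact: continuous_affine.
- by move=> _ [x Kx <-]; exact: KO.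
- move=> y Ky; apply: phi0 => KHy; apply: Ky; exists (H y) => //.
  exact: affineVK.
Qed.

Lemma test_function_affine phi :
  test_function O phi -> test_function O' (phi \o G).
Proof.
move=> [sphi [K [cK KO phi0]]]; split.
  by move=> k; exact: is_Ck_affine (sphi k).
exists (H @` K); split.
- apply: continuous_compact => //; apply: continuous_subspaceT.
  exact: continuous_affine.
- by move=> _ [x Kx <-]; rewrite /= affineVK//; exact: KO.
- move=> y Ky; apply: phi0 => KHy; apply: Ky; exists (G y) => //.
  exact: affineK.
Qed.

(** The chain rule formula for the gradient of v o G when g is the gradient of v. *)
Definition pull_gradient g : vec -> vec := fun x => A^T *m g (a + A *m x).

Lemma enorm_pull_gradient g x :
  enorm (pull_gradient g x) <= b * enorm (g (a + A *m x)).
Proof. exact: (enorm_tr_le (ltW b0) hb). Qed.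

(** The root of c comes from the change of variables, b from the bound on A^T. *)
Lemma l2norm_pull_gradient g :
  (l2norm O' (fun x => enorm (pull_gradient g x)) <=
   (Num.sqrt c * b)%:E * l2norm O (fun x => enorm (g x)))%E.
Proof.
rewrite -lee_sqr ?l2norm_ge0 ?mule_ge0 ?l2norm_ge0 ?lee_fin ?mulr_ge0 ?sqrtr_ge0 ?(ltW b0) ?(ltW c0)//.
have -> : (((Num.sqrt c * b)%:E * l2norm O (fun x => enorm (g x))) ^+ 2 =
    (b ^+ 2)%:E * (c%:E * l2norm O (fun x => enorm (g x)) ^+ 2))%E.
  rewrite !expe2 muleACA -EFinM [RHS]muleA -EFinM; congr (_%:E * _)%E.
  by rewrite mulrACA -(expr2 (Num.sqrt c)) sqr_sqrtr ?(ltW b0) ?(ltW c0)//; ring.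
rewrite -l2norm_affine !l2norm_sqr -ge0_integralZ ?exprn_gt0//.
apply: le_ge0_integral => x Ox; first by rewrite lee_fin sqr_ge0.
rewrite -EFinM lee_fin /= !ger0_norm ?enorm_ge0// -exprMn.
by rewrite ler_sqr ?nnegrE ?enorm_ge0 ?mulr_ge0 ?enorm_ge0 ?(ltW b0) ?(ltW c0)// enorm_pull_gradient.
Qed.

Lemma in_L2_enorm g : (forall i, in_L2 O (fun x => g x i ord0)) ->
  (l2norm O (fun x => enorm (g x)) < +oo)%E.
Proof.
move=> Lg; rewrite -expe2_lty ?l2norm_ge0// l2norm_sqr.
under eq_integral do rewrite ger0_norm ?enorm_ge0// enorm_sqr -sumEFin.
rewrite ge0_integral_sum//.
- apply: lte_sum_pinfty => i _; have [_] := Lg i.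
  rewrite -expe2_lty ?l2norm_ge0// l2norm_sqr; congr (_ < _)%E.
  by apply: eq_integral => x _; rewrite real_normK ?num_real.
- move=> i; have [mg _] := Lg i.
  by apply/measurable_EFinP; exact: measurable_funX.
- by move=> i x _; rewrite lee_fin sqr_ge0.
Qed.

Lemma pull_gradient_L2 g : (forall i, in_L2 O (fun x => g x i ord0)) ->
  forall i, in_L2 O' (fun x => pull_gradient g x i ord0).
Proof.
move=> Lg i; split.
  rewrite (_ : (fun x => pull_gradient g x i ord0) =
      (fun x => \sum_j A^T i j * g (a + A *m x) j ord0)); last first.
    by apply/funext => x; rewrite mxE.
  apply: measurable_sum => j; apply: measurable_funM; first exact: measurable_cst.
  apply: (measurable_comp mO _ (Lg j).1); first by move=> _ [x Ox <-].
  exact: measurable_funTS (measurable_affine a A).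
apply: (@le_lt_trans _ _ (l2norm O' (fun x => enorm (pull_gradient g x)))).
  rewrite -lee_sqr ?l2norm_ge0// !l2norm_sqr.
  apply: le_ge0_integral => x _; rewrite lee_fin ?sqr_ge0//.
  rewrite ler_sqr ?nnegrE// [leRHS]ger0_norm ?enorm_ge0//.
  exact: coor_le_enorm.
apply: le_lt_trans (l2norm_pull_gradient g) _.
rewrite lte_mul_pinfty ?lee_fin ?mulr_ge0 ?sqrtr_ge0 ?(ltW b0) ?(ltW c0)//.
exact: in_L2_enorm.
Qed.

(** A test function phi on O' is psi o G with psi a test function on O, and its j-th partial
    derivative is the sum of A_ij times those of psi, composed with G. After the change of
    variables, integrability splits the sums, and the identity for v tested against psi applies to
    each i. *)
Lemma weak_gradient_affine v g : in_L2 O v -> L2_weak_gradients O v g ->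
  L2_weak_gradients O' (v \o G) (pull_gradient g).
Proof.
move=> Lv [Lg wg]; split; first exact: pull_gradient_L2.
move=> phi j tphi; set psi := phi \o H.
have tpsi : test_function O psi by exact: test_function_affine_inv.
have [spsi _] := tpsi.
have [_ [dpsi cdpsi]] := spsi 1%N.
have cpsi i : continuous (partial i psi) by have [] := cdpsi i.
have phiE : phi = fun x => psi (a + A *m x).
  by apply/funext => x; rewrite /psi /= affineK.
have dphi x : partial j phi x = \sum_(i < n) A i j * partial i psi (a + A *m x).
  rewrite phiE.
  by have [_] := @is_derive_affine _ _ psi a A x j dpsi cpsi.
have Iv i : mu.-integrable O (EFin \o (fun x => v x * partial i psi x)).
  have [M hM] := test_function_partial_bounded i tpsi.
  exact: integrable_L2_bounded hM.
have Ig i : mu.-integrable O (EFin \o (fun x => g x i ord0 * psi x)).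
  have [M hM] := test_function_bounded tpsi.
  by apply: integrable_L2_bounded hM => //; exact: is_Ck_continuous (spsi 0).
transitivity (c%:E * \int[mu]_(x in O)
    (\sum_(i < n) A i j * (v x * partial i psi x))%:E)%E.
  rewrite -(integral_affine O (fun x => (\sum_(i < n) A i j * (v x * partial i psi x))%:E)).
  apply: eq_integral => x _; rewrite /= dphi mulr_sumr.
  by congr EFin; apply: eq_bigr => i _; rewrite mulrCA.
transitivity (- (c%:E * \int[mu]_(x in O)
    (\sum_(i < n) A i j * (g x i ord0 * psi x))%:E))%E; last first.
  rewrite -(integral_affine O (fun x => (\sum_(i < n) A i j * (g x i ord0 * psi x))%:E)).
  congr (- _)%E; apply: eq_integral => x _; rewrite /pull_gradient mxE mulr_suml.
  congr EFin; apply: eq_bigr => i _; rewrite mxE mulrA; congr (_ * _).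
  by rewrite /psi /= affineK.
rewrite !integral_lin// -!EFinM -EFinN -mulrN -sumrN.
congr (_ * _)%:E; apply: eq_bigr => i _; rewrite -mulrN; congr (_ * _).
by rewrite -fineN -wg.
Qed.

Lemma h1seminorm_ge0 (P : set vec) v : (0 <= h1seminorm P v)%E.
Proof. by apply: le_ereal_inf_tmp => _ [g _ <-]; exact: l2norm_ge0. Qed.

(** Every weak gradient of v on O supplies its pullback on O', so the bound for a single gradient
    passes to the infima. *)
Lemma h1seminorm_affine v : in_L2 O v ->
  (h1seminorm O' (v \o G) ^+ 2 <= (c * b ^+ 2)%:E * h1seminorm O v ^+ 2)%E.
Proof.
move=> Lv.
have k0 : 0 < Num.sqrt c * b by rewrite mulr_gt0 ?sqrtr_gt0.
have -> : ((c * b ^+ 2)%:E * h1seminorm O v ^+ 2 =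
    ((Num.sqrt c * b)%:E * h1seminorm O v) ^+ 2)%E.
  rewrite !expe2 muleACA -EFinM; congr (_%:E * _)%E.
  by rewrite mulrACA -(expr2 (Num.sqrt c)) sqr_sqrtr ?(ltW b0) ?(ltW c0)//.
rewrite lee_sqr ?h1seminorm_ge0 ?mule_ge0 ?h1seminorm_ge0 ?lee_fin ?(ltW k0)//.
rewrite muleC -lee_pdivrMr//; apply: le_ereal_inf_tmp => _ [g Hg <-].
rewrite lee_pdivrMr// muleC.
apply: le_trans (l2norm_pull_gradient g).
by apply: ereal_inf_lbound; exists (pull_gradient g) => //; exact: weak_gradient_affine.
Qed.

Lemma in_H1_affine v : in_H1 O v -> in_H1 O' (v \o G).
Proof.
move=> [Lv [g Hg]]; split; first exact: in_L2_affine.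
by exists (pull_gradient g); exact: weak_gradient_affine.
Qed.

(** The constant majorizes both c and c b^2. The estimate only serves to transfer approximability by
    test functions, so its size is immaterial. *)
Lemma h1norm_affine v : in_L2 O v ->
  (h1norm O' (v \o G) <= (Num.sqrt (c * (1 + b ^+ 2)))%:E * h1norm O v)%E.
Proof.
move=> Lv.
have s0 (P : set vec) w : (0 <= l2norm P w ^+ 2 + h1seminorm P w ^+ 2)%E.
  by rewrite adde_ge0// expe_ge0 ?l2norm_ge0 ?h1seminorm_ge0.
have C0 : 0 <= c * (1 + b ^+ 2) by rewrite mulr_ge0 ?addr_ge0 ?sqr_ge0 ?(ltW b0) ?(ltW c0).
rewrite -lee_sqr ?sqrte_ge0 ?mule_ge0 ?sqrte_ge0 ?lee_fin ?sqrtr_ge0//.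
rewrite /h1norm sqr_sqrte//.
set S := (l2norm O v ^+ 2 + _)%E.
have -> : (((Num.sqrt (c * (1 + b ^+ 2)))%:E * sqrte S) ^+ 2 =
    (c * (1 + b ^+ 2))%:E * S)%E.
  by rewrite expe2 muleACA -EFinM -expr2 sqr_sqrtr// -expe2 sqr_sqrte// s0.
rewrite ge0_muleDr ?expe_ge0 ?l2norm_ge0 ?h1seminorm_ge0//.
apply: leeD.
  rewrite l2norm_affine; apply: lee_wpmul2r; first by rewrite expe_ge0 ?l2norm_ge0.
  by rewrite lee_fin ler_peMr ?(ltW b0) ?(ltW c0)// lerDl sqr_ge0.
apply: le_trans (h1seminorm_affine Lv) _.
apply: lee_wpmul2r; first by rewrite expe_ge0 ?h1seminorm_ge0.
by rewrite lee_fin ler_pM2l// lerDr.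
Qed.

Lemma in_H10_affine v : in_H10 O v -> in_H10 O' (v \o G).
Proof.
move=> [Hv av]; split; first exact: in_H1_affine.
move=> eps eps0; pose C := Num.sqrt (c * (1 + b ^+ 2)).
have C0 : 0 < C by rewrite sqrtr_gt0 mulr_gt0// ltr_wpDr ?sqr_ge0.
have [phi tphi hphi] := av (eps / C) (divr_gt0 eps0 C0).
exists (phi \o G); first exact: test_function_affine.
(* Square-integrability of the difference is read off from its H1-norm being below a real number. *)
have Lvp : in_L2 O (v \- phi).
  split.
    apply: measurable_funB; first by case: Hv => -[].
    apply: measurable_funTS; apply: continuous_measurable_col.
    exact: is_Ck_continuous (tphi.1 0).
  rewrite -expe2_lty ?l2norm_ge0//.
  apply: (@le_lt_trans _ _ (h1norm O (v \- phi)%R ^+ 2)%E).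
    rewrite /h1norm [leRHS]sqr_sqrte ?adde_ge0 ?expe_ge0 ?l2norm_ge0 ?h1seminorm_ge0//.
    by rewrite leeDl// expe_ge0 ?h1seminorm_ge0.
  by rewrite expe2_lty ?sqrte_ge0// (lt_trans hphi)// ltry.
apply: (@le_lt_trans _ _ (C%:E * h1norm O (v \- phi)%R)%E).
  exact: h1norm_affine.
by rewrite muleC -lte_pdivlMr.
Qed.

Lemma ae_affine (P : vec -> Prop) :
  {ae mu, forall x, P x} -> {ae mu, forall x, P (a + A *m x)}.
Proof.
move=> [N [mN N0 PN]]; exists (G @^-1` N); split.
- by apply: measurable_preimage => //; exact: measurable_affine.
- by rewrite (lebesgueRn_affine a uA mN) N0 mule0.
- by move=> x nPx; exact: PN.
Qed.

(** * K-functional and interpolation norms *)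

Section interpolation.
Variables V V' : (vec -> R) -> Prop.
Hypotheses (VL2 : forall v, V v -> in_L2 O v).
Hypotheses (VV' : forall v, V v -> V' (v \o G)).

Lemma K_functional_ge0 (P : set vec) (W : (vec -> R) -> Prop) t v :
  (0 <= K_functional P W t v)%E.
Proof.
apply: le_ereal_inf_tmp => _ [vv _ <-].
by rewrite adde_ge0// ?mule_ge0 ?expe_ge0 ?l2norm_ge0 ?h1seminorm_ge0// lee_fin sqr_ge0.
Qed.

(** Decompositions of v pull back to decompositions of v o G. The gradient term gains c b^2, and t^2
    c b^2 = c (b t)^2 moves the surplus b into the argument. *)
Lemma K_functional_affine t v :
  (K_functional O' V' t (v \o G) <= c%:E * K_functional O V (b * t) v)%E.
Proof.
rewrite muleC -lee_pdivrMr//; apply: le_ereal_inf_tmp => _ [[v0 v1] /= [L0 V1 vE] <-].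
rewrite lee_pdivrMr// muleC.
apply: (@le_trans _ _ (l2norm O' (v0 \o G) ^+ 2 +
    (t ^+ 2)%:E * h1seminorm O' (v1 \o G) ^+ 2)%E).
  apply: ereal_inf_lbound; exists (v0 \o G, v1 \o G) => //=; split.
  - exact: in_L2_affine.
  - exact: VV'.
  - exact: (ae_affine vE).
rewrite ge0_muleDr ?mule_ge0 ?expe_ge0 ?l2norm_ge0 ?h1seminorm_ge0 ?lee_fin ?sqr_ge0//.
rewrite l2norm_affine leeD2l//.
apply: le_trans (lee_wpmul2l _ (h1seminorm_affine (VL2 V1))) _.
  by rewrite lee_fin sqr_ge0.
rewrite /=; move: (h1seminorm O v1 ^+ 2)%E => X.
rewrite muleA -EFinM [leRHS]muleA -EFinM.
by rewrite (_ : t ^+ 2 * _ = c * (b * t) ^+ 2)//; ring.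
Qed.

Lemma interp_norm_sqr (P : set vec) (W : (vec -> R) -> Prop) s v :
  (interp_norm P W s v ^+ 2 = \int[lebesgue_measure]_(t in `]0%R, +oo[)
    ((t `^ (- (2 * s)))%:E * K_functional P W t v * (t^-1)%:E))%E.
Proof.
rewrite sqr_sqrte//; apply: integral_ge0 => t; rewrite /= in_itv/= andbT => t0.
by rewrite !mule_ge0 ?K_functional_ge0 ?lee_fin ?powR_ge0 ?invr_ge0 ?(ltW t0).
Qed.

Lemma interp_norm_affine s v :
  (interp_norm O' V' s (v \o G) ^+ 2 <=
   (c * b `^ (2 * s))%:E * interp_norm O V s v ^+ 2)%E.
Proof.
rewrite [leLHS]interp_norm_sqr [X in (_ <= _ * X)%E]interp_norm_sqr.
pose h (t : R) : \bar R :=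
  ((t `^ (- (2 * s)))%:E * K_functional O V t v * (t^-1)%:E)%E.
have h0 (t : R) : 0 < t -> (0 <= h t)%E.
  move=> t0.
  by rewrite !mule_ge0 ?K_functional_ge0 ?lee_fin ?powR_ge0 ?invr_ge0 ?(ltW t0).
have B0 : 0 < b `^ (2 * s) by exact: powR_gt0.
(* The weights inside h(b t) contribute b^(-2s) and b^-1, which [k] compensates; the substitution
   then gives back b^-1 and leaves c b^(2s). *)
pose k := c * b `^ (2 * s) * b.
have k0 : 0 < k by rewrite !mulr_gt0.
have hle (t : R) : 0 < t -> ((t `^ (- (2 * s)))%:E *
    K_functional O' V' t (v \o G) * (t^-1)%:E <= k%:E * h (b * t)%R)%E.
  move=> t0; have tV0 : (0 <= (t^-1)%:E)%E by rewrite lee_fin invr_ge0 ltW.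
  have pt0 : (0 <= (t `^ (- (2 * s)))%:E)%E by rewrite lee_fin powR_ge0.
  apply: le_trans (lee_wpmul2r tV0 (lee_wpmul2l pt0 (K_functional_affine t v))) _.
  rewrite /h; move: (K_functional O V (b * t) v) => K.
  rewrite [X in (X <= _)%E](_ : _ = (t `^ (- (2 * s)) * c * t^-1)%:E * K)%E; last first.
    by rewrite muleA -EFinM muleAC -EFinM.
  rewrite [X in (_ <= _ * X)%E]muleAC -EFinM muleA -EFinM.
  rewrite powRM ?(ltW b0) ?(ltW t0)// !powRN invfM.
  rewrite (_ : k * _ = (t `^ (2 * s))^-1 * c * t^-1)// /k.
  have T0 : 0 < t `^ (2 * s) by exact: powR_gt0.
  by field; rewrite !(gt_eqF t0, gt_eqF b0, gt_eqF B0, gt_eqF T0).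
have E := integral_scale h b0.
have -> : ((c * b `^ (2 * s))%:E *
    \int[lebesgue_measure]_(t in `]0%R, +oo[) h t =
    \int[lebesgue_measure]_(t in `]0%R, +oo[) (k%:E * h (b * t)%R))%E.
  rewrite ge0_integralZ//; last first.
    by move=> t; rewrite /= in_itv/= andbT => t0; apply: h0; exact: mulr_gt0.
  by rewrite E muleA -EFinM mulfK ?gt_eqF.
apply: le_ge0_integral => t; rewrite /= in_itv/= andbT => t0; last exact: hle.
by rewrite !mule_ge0 ?K_functional_ge0 ?lee_fin ?powR_ge0 ?invr_ge0 ?(ltW t0).
Qed.

End interpolation.

End affine_pullback.

(** * Geometry of domains and fractional norms *)

Section domain_geometry.
Context {R : realType} {n : nat}.
Local Notation vec := 'cV[R]_n.
Implicit Types (S O : set vec) (x y : vec).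

(** A crude bound by the sum of the entries, used to see that affine preimages of bounded sets are
    bounded. *)
Lemma mulmx_enorm_bounded (A : 'M[R]_n) :
  exists k : R, forall x, enorm (A *m x) <= k * enorm x.
Proof.
exists (\sum_(i < n) \sum_(j < n) `|A i j|) => x.
apply: le_trans (enorm_le_sum _) _; rewrite mulr_suml; apply: ler_sum => i _.
rewrite mxE mulr_suml; apply: le_trans (ler_norm_sum _ _ _) _.
by apply: ler_sum => j _; rewrite normrM ler_wpM2l// coor_le_enorm.
Qed.

Lemma bounded_enorm S : bounded_set S -> exists M : R, forall x, S x -> enorm x <= M.
Proof.
move=> [M [_ hM]]; exists (n%:R * (`|M| + 1)) => x Sx.
apply: le_trans (enorm_le_norm x) _; rewrite ler_wpM2l//.
by apply: hM => //; apply: le_lt_trans (ler_norm M) _; rewrite ltrDl.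
Qed.

Lemma enorm_bounded S (M : R) : (forall x, S x -> enorm x <= M) -> bounded_set S.
Proof.
move=> hM; exists M; split; first exact: num_real.
by move=> y My x Sx; apply: le_trans (norm_le_enorm x) _; apply: le_trans (hM _ Sx) (ltW My).
Qed.

Lemma bounded_affine_preimage (a : vec) (A : 'M[R]_n) S : A \in unitmx ->
  bounded_set S -> bounded_set ((fun x => a + A *m x) @^-1` S).
Proof.
move=> uA /bounded_enorm[M hM]; have [k hk] := mulmx_enorm_bounded (invmx A).
apply: (@enorm_bounded _ (`|k| * (M + enorm a))) => x Sx.
rewrite -(mulKmx uA x); apply: le_trans (hk _) _.
apply: le_trans (ler_wpM2r (enorm_ge0 _) (ler_norm k)) _.
rewrite ler_wpM2l// -(addKr a (A *m x)) addrC.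
by apply: le_trans (ler_enormD _ _) _; rewrite enormN lerD2r; exact: hM.
Qed.

Lemma open_affine_preimage (a : vec) (A : 'M[R]_n) S :
  open S -> open ((fun x => a + A *m x) @^-1` S).
Proof. by move=> oS; apply: open_comp => // x _; exact: continuous_affine. Qed.

Lemma enorm_le_diam S x y : bounded_set S -> S x -> S y -> enorm (x - y) <= diam S.
Proof.
move=> /bounded_enorm[M hM] Sx Sy.
apply: sup_ubound; last by exists x => //; exists y.
exists (M + M) => _ [u Su [w Sw <-]].
by apply: le_trans (ler_enormD _ _) _; rewrite enormN lerD ?hM.
Qed.

Lemma eball_center x (r : R) : 0 < r -> eball x r x.
Proof. by move=> r0; rewrite /eball /= subrr enorm0. Qed.

Lemma diam_eball_le x (r : R) : 0 < r -> diam (eball x r) <= 2 * r.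
Proof.
move=> r0; apply: sup_le_ub.
  by exists (enorm (x - x)); exists x; [exact: eball_center|exists x; [exact: eball_center|]].
move=> _ [u xu [w xw <-]].
rewrite (_ : u - w = (x - w) - (x - u)); last by apply/colP => i; rewrite !mxE; ring.
apply: le_trans (ler_enormD _ _) _; rewrite enormN mulr2n mulrDl mul1r.
by rewrite lerD// ltW.
Qed.

Lemma bounded_eball x (r : R) : bounded_set (eball x r).
Proof.
apply: (@enorm_bounded _ (enorm x + r)) => y xy.
rewrite -(subKr x y); apply: le_trans (ler_enormD _ _) _.
by rewrite enormN lerD2l ltW.
Qed.

Lemma sub_eball_diam S x (r : R) : bounded_set S -> 0 < r -> eball x r `<=` S ->
  diam (eball x r) <= diam S.
Proof.
move=> bS r0 xrS; apply: sup_le_ub.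
  by exists (enorm (x - x)); exists x; [exact: eball_center|exists x; [exact: eball_center|]].
by move=> _ [u xu [w xw <-]]; apply: enorm_le_diam => //; exact: xrS.
Qed.

Lemma diam_eball_gt0 x (r : R) : (0 < n)%N -> 0 < r -> 0 < diam (eball x r).
Proof.
move=> n0 r0; pose u : vec := const_mx 1.
have u0 : 0 < enorm u.
  by apply: lt_le_trans (coor_le_enorm u (Ordinal n0)); rewrite mxE normr1.
(* A point at distance r/2 from the centre in the direction (1, ..., 1), which is nonzero as n >
   0. *)
pose y := x + (r / 2 / enorm u) *: u.
have k0 : 0 < r / 2 / enorm u by rewrite !divr_gt0.
have yE : enorm (x - y) = r / 2.
  by rewrite /y opprD addrA subrr add0r enormN enormZ gtr0_norm// divfK ?gt_eqF.
apply: (@lt_le_trans _ _ (enorm (x - y))); first by rewrite yE divr_gt0.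
apply: enorm_le_diam; first exact: bounded_eball.
  exact: eball_center.
by rewrite /eball /= yE; lra.
Qed.

Lemma open_eball S x : open S -> S x -> exists2 r : R, 0 < r & eball x r `<=` S.
Proof.
move=> oS Sx; have /nbhs_ballP[e /= e0 eS] : nbhs x S by exact: open_nbhs_nbhs.
exists e => // y xy; apply: eS; rewrite -ball_normE /=.
exact: le_lt_trans (norm_le_enorm _) xy.
Qed.

Section inball.
Variable O : set vec.
Hypotheses (n0 : (0 < n)%N) (oO : open O) (bO : bounded_set O) (neO : O !=set0).

Let balls := [set diam (eball p.1 p.2) |
  p in [set p : vec * R | 0 < p.2 /\ eball p.1 p.2 `<=` O]].

Let has_sup_balls : has_sup balls.
Proof.
split.
  have [x Ox] := neO; have [r r0 rO] := open_eball oO Ox.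
  by exists (diam (eball x r)); exists (x, r).
by exists (diam O) => _ [[x r] /= [r0 rO] <-]; exact: sub_eball_diam.
Qed.

Lemma inball_diam_gt0 : 0 < inball_diam O.
Proof.
have [x Ox] := neO; have [r r0 rO] := open_eball oO Ox.
apply: (lt_le_trans (diam_eball_gt0 x n0 r0)).
by apply: sup_ubound; [exact: has_sup_balls.2|exists (x, r)].
Qed.

Lemma diam_gt0 : 0 < diam O.
Proof.
apply: lt_le_trans inball_diam_gt0 _; apply: sup_le_ub; first exact: has_sup_balls.1.
by move=> _ [[x r] /= [r0 rO] <-]; exact: sub_eball_diam.
Qed.

Lemma inball_diam_le (M : R) :
  (forall x r, 0 < r -> eball x r `<=` O -> 2 * r <= M) -> inball_diam O <= M.
Proof.
move=> hM; apply: sup_le_ub; first exact: has_sup_balls.1.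
move=> _ [[x r] /= [r0 rO] <-]; apply: le_trans (diam_eball_le x r0) _.
exact: hM rO.
Qed.

End inball.

(* A ball of diameter 2r in the preimage has image points at distance
   arbitrarily close to 2r |A x| / |x|. *)
Lemma mulmx_enorm_le (a : vec) (A : 'M[R]_n) O : (0 < n)%N -> A \in unitmx ->
  open O -> bounded_set O -> O !=set0 ->
  forall x, enorm (A *m x) <=
    diam O / inball_diam ((fun x => a + A *m x) @^-1` O) * enorm x.
Proof.
move=> n0 uA oO bO [z Oz] x; set O' := _ @^-1` O.
have oO' : open O' by exact: open_affine_preimage.
have bO' : bounded_set O' by exact: bounded_affine_preimage.
have neO' : O' !=set0.
  by exists (invmx A *m (z - a)); rewrite /O' /= mulKVmx// addrC subrK.
have d0 := inball_diam_gt0 n0 oO' bO' neO'.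
have D0 := diam_gt0 n0 oO bO (ex_intro _ z Oz).
have [x0|x0] := eqVneq (enorm x) 0.
  by rewrite (enorm_eq0 x0) mulmx0 !enorm0 mulr0.
have xp : 0 < enorm x by rewrite lt_neqAle eq_sym x0 enorm_ge0.
have [Ax0|Ax0] := eqVneq (enorm (A *m x)) 0.
  by rewrite Ax0 !mulr_ge0// ?invr_ge0 ltW.
have Axp : 0 < enorm (A *m x) by rewrite lt_neqAle eq_sym Ax0 enorm_ge0.
rewrite mulrAC ler_pdivlMr// mulrC -ler_pdivlMr//.
(* The claim has been solved for the inscribed diameter of O', so it reduces to a bound on the
   radius of each ball in O'. *)
apply: inball_diam_le => // p r r0 prO.
(* The balls are open, so the antipodal points p + w and p - w are taken at radius t < r with 2 r <=
   2 t + e; the maximum with 0 covers e > 2 r. *)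
apply/ler_addgt0Pr => e e0; pose t := Num.max (r - e / 2) 0.
have t0 : 0 <= t by rewrite le_max lexx orbT.
have tr : t < r by rewrite gt_max r0 andbT; lra.
have te : 2 * r <= 2 * t + e.
  have : r - e / 2 <= t by rewrite le_max lexx.
  by lra.
apply: le_trans te _; rewrite lerD2r ler_pdivlMr//.
pose w : vec := (t / enorm x) *: x.
have wE : enorm w = t.
  by rewrite /w enormZ ger0_norm ?divfK// divr_ge0// enorm_ge0.
have O1 : O (a + A *m (p + w)).
  by apply: prO; rewrite /eball /= opprD addrA subrr add0r enormN wE.
have O2 : O (a + A *m (p - w)).
  by apply: prO; rewrite /eball /= opprB addrC subrK wE.
have := enorm_le_diam bO O1 O2.
rewrite (_ : _ - _ = (2 * (t / enorm x)) *: (A *m x)); last first.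
  rewrite !mulmxDr mulmxN /w -scalemxAr mulr2n mulrDl mul1r scalerDl.
  by rewrite !opprD opprK addrACA subrr add0r addrACA subrr add0r.
rewrite enormZ ger0_norm ?mulr_ge0 ?divr_ge0 ?invr_ge0 ?(ltW xp)//.
by rewrite mulrA -mulrAC ler_pdivrMr.
Qed.

Lemma interior_affine (a : vec) (A : 'M[R]_n) S : A \in unitmx ->
  ((fun x => a + A *m x) @^-1` S)° = (fun x => a + A *m x) @^-1` (S°).
Proof.
move=> uA; apply/seteqP; split => x.
  have Hx : - (invmx A *m a) + invmx A *m (a + A *m x) = x := affineK a uA x.
  have cH : (fun y => - (invmx A *m a) + invmx A *m y) @ (a + A *m x) --> x.
    by rewrite -[X in _ --> X]Hx; exact: continuous_affine.
  move=> Sx; have {}Sx : nbhs (a + A *m x)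
      ((fun y => - (invmx A *m a) + invmx A *m y) @^-1`
       ((fun x => a + A *m x) @^-1` S)) := cH _ Sx.
  apply: filterS Sx => y /=.
  by rewrite (affineVK a uA y).
by move=> /= Sx; exact: (@continuous_affine _ _ _ a A x _ Sx).
Qed.

(** The closure is the complement of the interior of the complement, so the statement for interiors
    suffices. *)
Lemma bdry_affine (a : vec) (A : 'M[R]_n) S : A \in unitmx ->
  bdry ((fun x => a + A *m x) @^-1` S) = (fun x => a + A *m x) @^-1` (bdry S).
Proof.
move=> uA; rewrite /bdry interior_affine// (_ : closure (_ @^-1` S) =
  (fun x => a + A *m x) @^-1` (closure S))//.
rewrite -(setCK (closure S)) -interiorC -preimage_setC -interior_affine//.
by rewrite preimage_setC interiorC setCK.
Qed.

Let dist_has_lbound x S : has_lbound [set enorm (x - y) | y in S].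
Proof. by exists 0 => _ [y _ <-]; exact: enorm_ge0. Qed.

(** The infimum of the empty set is 0 by convention, which makes the comparison of distances hold
    for empty sets too. *)
Lemma dist_set0 x : dist x (set0 : set vec) = 0.
Proof. by rewrite /dist image_set0 inf0. Qed.

Lemma dist_ge0 x S : 0 <= dist x S.
Proof.
have [->|/set0P[y Sy]] := eqVneq S set0; first by rewrite dist_set0.
apply: lb_le_inf; first by exists (enorm (x - y)); exists y.
by move=> _ [z _ <-]; exact: enorm_ge0.
Qed.

Lemma dist_affine_le (a : vec) (A : 'M[R]_n) (b : R) S x : A \in unitmx -> 0 < b ->
  (forall x, enorm (A *m x) <= b * enorm x) ->
  dist (a + A *m x) S <= b * dist x ((fun x => a + A *m x) @^-1` S).
Proof.
move=> uA b0 hb; have [->|/set0P[y Sy]] := eqVneq S set0.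
  by rewrite preimage_set0 !dist_set0 mulr0.
rewrite -ler_pdivrMl//; apply: lb_le_inf.
  pose z := - (invmx A *m a) + invmx A *m y.
  exists (enorm (x - z)); exists z => //.
  by rewrite /z /= (affineVK a uA y).
move=> _ [z /= Sz <-]; rewrite ler_pdivrMl//; apply: le_trans (hb _).
rewrite mulmxBr (_ : A *m x - A *m z = (a + A *m x) - (a + A *m z)); last first.
  by rewrite opprD addrACA subrr add0r.
by apply: ge_inf => //; exists (a + A *m z).
Qed.

End domain_geometry.

(** * Slobodeckij seminorm and boundary weight *)

Section fractional_norms.
Context {R : realType} {n : nat}.
Local Notation vec := 'cV[R]_n.
Local Notation mu := (lebesgueRn R n).
Variables (a : vec) (A : 'M[R]_n) (O : set vec) (b b' c s : R).
Hypothesis uA : A \in unitmx.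
Hypotheses (b0 : 0 < b) (hb : forall x : vec, enorm (A *m x) <= b * enorm x).
Hypotheses (b'0 : 0 < b') (hb' : forall x : vec, enorm (invmx A *m x) <= b' * enorm x).
Hypotheses (c0 : 0 < c) (hc : volume_factor A = c%:E).
Hypothesis s0 : 0 < s.
Local Notation G := (fun x : vec => a + A *m x).
Local Notation O' := (G @^-1` O).
Implicit Types (v : vec -> R).

Lemma slobodeckij_sqr (P : set vec) v :
  (slobodeckij P s v ^+ 2 = \int[mu]_(y in P) \int[mu]_(x in P)
    (`|v x - v y| ^+ 2 / enorm (x - y) `^ (n%:R + 2 * s))%:E)%E.
Proof.
rewrite sqr_sqrte//; apply: integral_ge0 => y _; apply: integral_ge0 => x _.
by rewrite lee_fin divr_ge0 ?sqr_ge0 ?powR_ge0.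
Qed.

(** The kernel is compared pointwise, |x - y|^-p <= b^p |A (x - y)|^-p with p = n + 2 s, and each of
    the two integrals contributes a factor c. *)
Lemma slobodeckij_affine v :
  (slobodeckij O' s (v \o G) ^+ 2 <=
   (c ^+ 2 * b `^ (n%:R + 2 * s))%:E * slobodeckij O s v ^+ 2)%E.
Proof.
rewrite [leLHS]slobodeckij_sqr [X in (_ <= _ * X)%E]slobodeckij_sqr.
set p := n%:R + 2 * s.
have p0 : 0 < p by rewrite ltr_pwDr ?ler0n// mulr_gt0.
pose k (x y : vec) : \bar R := (`|v x - v y| ^+ 2 / enorm (x - y) `^ p)%:E.
have k0 x y : (0 <= k x y)%E by rewrite lee_fin divr_ge0 ?sqr_ge0 ?powR_ge0.
have bp0 : 0 < b `^ p by exact: powR_gt0.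
have kle x y : ((`|v (a + A *m x) - v (a + A *m y)| ^+ 2 / enorm (x - y) `^ p)%:E
    <= (b `^ p)%:E * k (a + A *m x)%R (a + A *m y)%R)%E.
  rewrite /k -EFinM lee_fin mulrCA ler_wpM2l ?sqr_ge0//.
  rewrite (_ : a + A *m x - (a + A *m y) = A *m (x - y)); last first.
    by rewrite mulmxBr opprD addrACA subrr add0r.
  (* On the diagonal the left side vanishes, because 0^p = 0 and the inverse of 0 is 0. *)
  have [xy|xy] := eqVneq (enorm (x - y)) 0.
    by rewrite xy powR0 ?gt_eqF// invr0 mulr_ge0 ?invr_ge0 ?powR_ge0.
  have xy0 : 0 < enorm (x - y) by rewrite lt_neqAle eq_sym xy enorm_ge0.
  have Axy0 : 0 < enorm (A *m (x - y)).
    rewrite lt_neqAle enorm_ge0 andbT eq_sym; apply: contra_neq xy => /enorm_eq0 E.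
    by rewrite -(mulKmx uA (x - y)) E mulmx0 enorm0.
  rewrite -[leLHS]mul1r ler_pdivrMr ?powR_gt0// mulrAC ler_pdivlMr ?powR_gt0// mul1r.
  rewrite -powRM ?(ltW b0) ?(ltW xy0)//.
  by apply: ge0_ler_powR; rewrite ?nnegrE ?enorm_ge0 ?mulr_ge0 ?(ltW b0) ?(ltW p0) ?enorm_ge0.
pose J (y : vec) := (\int[mu]_(x in O) k x y)%E.
have J0 y : (0 <= J y)%E by apply: integral_ge0 => x _.
have -> : ((c ^+ 2 * b `^ p)%:E * \int[mu]_(y in O) J y =
    \int[mu]_(y in O') \int[mu]_(x in O')
      ((b `^ p)%:E * k (a + A *m x)%R (a + A *m y)%R))%E.
  transitivity (\int[mu]_(y in O') ((b `^ p * c)%:E * J (a + A *m y)%R))%E.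
    rewrite [RHS]ge0_integralZ; [|exact: mulr_gt0|by move=> y _].
    rewrite (integral_affine a uA c0 hc O J) [RHS]muleA -EFinM.
    by congr (_%:E * _)%E; ring.
  apply: eq_integral => y _; rewrite [RHS]ge0_integralZ; [|exact: bp0|by move=> x _].
  by rewrite (integral_affine a uA c0 hc O (fun x => k x (a + A *m y))) [RHS]muleA -EFinM.
apply: le_ge0_integral => y _.
  by apply: integral_ge0 => x _; rewrite lee_fin divr_ge0 ?sqr_ge0 ?powR_ge0.
apply: le_ge0_integral => x _; last exact: kle.
by rewrite lee_fin divr_ge0 ?sqr_ge0 ?powR_ge0.
Qed.

(** G maps the boundary of O' onto that of O and increases distances at most by the factor b, so the
    weight gains at most b^s before squaring. *)
Lemma weighted_l2norm_affine v :
  (l2norm O' (fun x => (v \o G) x / dist x (bdry O') `^ s)%R ^+ 2 <=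
   (c * b `^ (2 * s))%:E * l2norm O (fun x => v x / dist x (bdry O) `^ s)%R ^+ 2)%E.
Proof.
rewrite [leLHS]l2norm_sqr [X in (_ <= _ * X)%E]l2norm_sqr.
pose w (x : vec) : \bar R := (`|v x / dist x (bdry O) `^ s| ^+ 2)%:E.
have B0 : 0 < b `^ (2 * s) by exact: powR_gt0.
have -> : ((c * b `^ (2 * s))%:E * \int[mu]_(x in O) w x =
    \int[mu]_(x in O') ((b `^ (2 * s))%:E * w (a + A *m x)%R))%E.
  rewrite [RHS]ge0_integralZ; [|exact: B0|by move=> x _; rewrite lee_fin sqr_ge0].
  rewrite (integral_affine a uA c0 hc O w) [RHS]muleA -EFinM.
  by congr (_%:E * _)%E; ring.
have B2 : b `^ (2 * s) = (b `^ s) ^+ 2 by rewrite mulrC powRrM powR_mulrn ?powR_ge0.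
apply: le_ge0_integral => x _; first by rewrite lee_fin sqr_ge0.
rewrite /w -EFinM lee_fin B2 -exprMn ler_sqr ?nnegrE ?mulr_ge0 ?powR_ge0 ?normr_ge0//.
rewrite /=.
move: (v _) => vx.
set d' := dist x _; set d := dist _ _.
have dd' : d <= b * d' by rewrite /d /d' (bdry_affine a O uA); exact: dist_affine_le.
(* The bound on the inverse map excludes d = 0 < d', where the convention that the inverse of 0 is 0
   would falsify the comparison of weights. *)
have d'd : d' <= b' * d.
  have E1 : (fun y => - (invmx A *m a) + invmx A *m y) @^-1` (bdry O') = bdry O.
    rewrite (bdry_affine a O uA); apply/seteqP; split => y /=.
      by rewrite (affineVK a uA y).
    by rewrite (affineVK a uA y).
  have E2 : - (invmx A *m a) + invmx A *m (a + A *m x) = x := affineK a uA x.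
  have uV : invmx A \in unitmx by rewrite unitmx_inv.
  have := dist_affine_le (- (invmx A *m a)) (bdry O') (a + A *m x) uV b'0 hb'.
  by rewrite E1 E2.
have d'ge0 : 0 <= d' by exact: dist_ge0.
have dge0 : 0 <= d by exact: dist_ge0.
move: d' d dd' d'd d'ge0 dge0 => d' d dd' d'd d'ge0 dge0.
rewrite !normrM !normfV ![`|_ `^ _|]ger0_norm ?powR_ge0// mulrCA ler_wpM2l//.
have [d'0|d'0] := eqVneq d' 0.
  by rewrite d'0 powR0 ?gt_eqF// invr0 mulr_ge0 ?invr_ge0 ?powR_ge0.
have d'gt0 : 0 < d' by rewrite lt_neqAle eq_sym d'0.
have dgt0 : 0 < d by rewrite -(pmulr_rgt0 _ b'0) (lt_le_trans d'gt0).
rewrite -[leLHS]mul1r ler_pdivrMr ?powR_gt0// mulrAC ler_pdivlMr ?powR_gt0// mul1r.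
rewrite -powRM ?(ltW b0)//.
by apply: ge0_ler_powR; rewrite ?nnegrE ?mulr_ge0 ?(ltW b0) ?(ltW s0) ?(ltW dgt0).
Qed.

Lemma tilde_norm_sqr (P : set vec) v : (tilde_norm P s v ^+ 2 =
  slobodeckij P s v ^+ 2 + l2norm P (fun x => v x / dist x (bdry P) `^ s)%R ^+ 2)%E.
Proof.
by rewrite sqr_sqrte// adde_ge0// expe_ge0// sqrte_ge0.
Qed.

(** With c b^(2s) factored out, the seminorm part costs c b^n and the weighted part 1, whence the
    maximum. *)
Lemma tilde_norm_affine v :
  (tilde_norm O' s (v \o G) ^+ 2 <=
   (c * b `^ (2 * s) * Num.max (c * b ^+ n) 1)%:E * tilde_norm O s v ^+ 2)%E.
Proof.
rewrite [leLHS]tilde_norm_sqr [X in (_ <= _ * X)%E]tilde_norm_sqr.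
have B0 : 0 < b `^ (2 * s) by exact: powR_gt0.
have cB0 : 0 <= c * b `^ (2 * s) by rewrite mulr_ge0 ?(ltW c0) ?(ltW B0).
rewrite ge0_muleDr ?expe_ge0 ?sqrte_ge0//.
apply: leeD.
  apply: le_trans (slobodeckij_affine v) _.
  apply: lee_wpmul2r; first by rewrite expe_ge0 ?sqrte_ge0.
  rewrite lee_fin powRD; last by rewrite (gt_eqF b0) implybT.
  rewrite powR_mulrn ?(ltW b0)//.
  rewrite (_ : c ^+ 2 * _ = c * b `^ (2 * s) * (c * b ^+ n)); last by ring.
  by rewrite ler_wpM2l// le_max lexx.
apply: le_trans (weighted_l2norm_affine v) _.
apply: lee_wpmul2r; first by rewrite expe_ge0 ?sqrte_ge0.
by rewrite lee_fin ler_peMr// le_max lexx orbT.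
Qed.

End fractional_norms.

(** * Scaling estimates *)

Section affine_scaling.
Context {R : realType} {n : nat}.
Local Notation vec := 'cV[R]_n.

Lemma max_factor_le (k k' p q : R) : 0 <= k -> k <= k' -> 0 <= p -> 0 <= q ->
  k * p * Num.max (k * q) 1 <= k' * p * Num.max (k' * q) 1.
Proof.
move=> k0 kk' p0 q0; apply: ler_pM.
- exact: mulr_ge0.
- by rewrite le_max ler01 orbT.
- by rewrite ler_wpM2r.
- by rewrite ge_max !le_max lexx orbT andbT ler_wpM2r.
Qed.

(** The bound on A^-1 is the bound for linear parts applied to the inverse map, whose preimage of O'
    is O. It yields c <= [beta], and all constants are monotone in c, so c can be eliminated in
    favour of diameters. *)
Lemma affine_scaling (a : vec) (A : 'M[R]_n) (O : set vec) (s : R) :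
  (0 < n)%N -> A \in unitmx -> open O -> bounded_set O -> O !=set0 -> 0 < s ->
  let G := fun x : vec => a + A *m x in
  let O' := G @^-1` O in
  let beta := (diam O' / inball_diam O) `^ n%:R in
  let b := diam O / inball_diam O' in
  forall v : vec -> R,
  [/\ (interp_L2_H10 O' s (v \o G) ^+ 2 <=
        (beta * b `^ (2 * s))%:E * interp_L2_H10 O s v ^+ 2)%E,
      (interp_L2_H1 O' s (v \o G) ^+ 2 <=
        (beta * b `^ (2 * s))%:E * interp_L2_H1 O s v ^+ 2)%E,
      (slobodeckij O' s (v \o G) ^+ 2 <=
        (beta ^+ 2 * b `^ (n%:R + 2 * s))%:E * slobodeckij O s v ^+ 2)%E &
      (tilde_norm O' s (v \o G) ^+ 2 <=
        (beta * b `^ (2 * s) * Num.max (beta * b `^ n%:R) 1)%:E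
          * tilde_norm O s v ^+ 2)%E].
Proof.
move=> n0 uA oO bO neO s0 G O' beta b v.
have uV : invmx A \in unitmx by rewrite unitmx_inv.
have oO' : open O' by exact: open_affine_preimage.
have bO' : bounded_set O' by exact: bounded_affine_preimage.
have neO' : O' !=set0.
  have [z Oz] := neO; exists (- (invmx A *m a) + invmx A *m z).
  by rewrite /O' /G /= (affineVK a uA z).
have OE : (fun y => - (invmx A *m a) + invmx A *m y) @^-1` O' = O.
  by apply/seteqP; split => y; rewrite /O' /G /= (affineVK a uA y).
have b0 : 0 < b by rewrite divr_gt0 ?diam_gt0 ?inball_diam_gt0.
pose b' := diam O' / inball_diam O.
have b'0 : 0 < b' by rewrite divr_gt0 ?diam_gt0 ?inball_diam_gt0.
have hb : forall x : vec, enorm (A *m x) <= b * enorm x by exact: mulmx_enorm_le.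
have hb' : forall x : vec, enorm (invmx A *m x) <= b' * enorm x.
  have := mulmx_enorm_le (- (invmx A *m a)) n0 uV oO' bO' neO'.
  by rewrite OE.
have [c c0 hc] := volume_factor_gt0 uA.
have cb : c <= beta.
  by have := volume_factor_le n0 uA b'0 hb'; rewrite hc lee_fin /beta powR_mulrn ?(ltW b'0).
have le_coef (k k' : R) (X Y : \bar R) : k <= k' -> (0 <= Y)%E ->
    (X <= k%:E * Y)%E -> (X <= k'%:E * Y)%E.
  move=> kk' Y0 XY; apply: le_trans XY _.
  by apply: lee_wpmul2r => //; rewrite lee_fin.
have c2 : c ^+ 2 <= beta ^+ 2.
  by rewrite ler_sqr ?nnegrE ?(ltW c0) ?powR_ge0.
have sq0 (x : \bar R) : (0 <= sqrte x ^+ 2)%E by rewrite expe_ge0 ?sqrte_ge0.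
split.
- apply: (le_coef (c * b `^ (2 * s))); [by rewrite ler_wpM2r ?powR_ge0|exact: sq0|].
  apply: (interp_norm_affine uA oO bO b0 hb c0 hc) => [w [[]]//|w].
  exact: (in_H10_affine a uA oO bO b0 hb c0 hc).
- apply: (le_coef (c * b `^ (2 * s))); [by rewrite ler_wpM2r ?powR_ge0|exact: sq0|].
  apply: (interp_norm_affine uA oO bO b0 hb c0 hc) => [w []//|w].
  exact: (in_H1_affine a uA oO bO b0 hb c0 hc).
- apply: (le_coef (c ^+ 2 * b `^ (n%:R + 2 * s)));
    [by rewrite ler_wpM2r ?powR_ge0|exact: sq0|].
  exact: (slobodeckij_affine a O uA b0 hb c0 hc s0).
- apply: (le_coef (c * b `^ (2 * s) * Num.max (c * b ^+ n) 1)); [|exact: sq0|].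
    rewrite (powR_mulrn n (ltW b0)).
    exact: (max_factor_le (ltW c0) cb (powR_ge0 b _) (exprn_ge0 n (ltW b0))).
  exact: (tilde_norm_affine a O uA b0 hb b'0 hb' c0 hc s0).
Qed.

End affine_scaling.

(** * Arithmetic of the constants *)

Section scaling_factors.
Context {R : realType}.
Variables (D d D' d' N s : R).
Hypotheses (D0 : 0 < D) (d0 : 0 < d) (D'0 : 0 < D') (d'0 : 0 < d').

(** Powers as exponentials make each identity below a polynomial identity in N, s and the logarithms
    of the four diameters. *)
Let powRE (x e : R) : 0 < x -> x `^ e = expR (e * ln x).
Proof. by move=> x0; rewrite /powR gt_eqF. Qed.

Let lnE (x y : R) : 0 < x -> 0 < y -> ln (x / y) = ln x - ln y.
Proof. by move=> x0 y0; rewrite ln_div. Qed.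

Let r0 : (0 < D / d) * (0 < D' / d') * (0 < D / d') * (0 < D' / d).
Proof. by rewrite !divr_gt0. Qed.

Lemma interp_factor :
  D `^ (N - 2 * s) * (D / d) `^ (2 * s) * D' `^ (2 * s - N) * (D' / d') `^ N =
  (D / d') `^ N * (D' / d) `^ (2 * s).
Proof. by rewrite !powRE ?r0// !lnE// -!expRD; congr expR; ring. Qed.

Lemma interp_factor_inv :
  D `^ (N - 2 * s) * (D / d) `^ (- N) * D' `^ (2 * s - N) * (D' / d') `^ (- (2 * s)) =
  ((D' / d) `^ N * (D / d') `^ (2 * s))^-1.
Proof. by rewrite !powRE ?r0// !lnE// -!expRD -expRN; congr expR; ring. Qed.

Lemma slobodeckij_factor :
  D `^ (N - 2 * s) * (D / d) `^ (N + 2 * s) * D' `^ (2 * s - N) * (D' / d') `^ (2 * N) =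
  ((D / d') `^ N) ^+ 2 * (D' / d) `^ (N + 2 * s).
Proof. by rewrite expr2 !powRE ?r0// !lnE// -!expRD; congr expR; ring. Qed.

Lemma slobodeckij_factor_inv :
  D `^ (N - 2 * s) * (D / d) `^ (- (2 * N)) * D' `^ (2 * s - N) * (D' / d') `^ (- N - 2 * s) =
  (((D' / d) `^ N) ^+ 2 * (D / d') `^ (N + 2 * s))^-1.
Proof. by rewrite expr2 !powRE ?r0// !lnE// -!expRD -expRN; congr expR; ring. Qed.

Lemma tilde_factor : (D / d') `^ N * (D' / d) `^ N = (D / d) `^ N * (D' / d') `^ N.
Proof. by rewrite !powRE ?r0// !lnE// -!expRD; congr expR; ring. Qed.

(** The minimum in the lower constant is the reciprocal of the maximum in the upper one. *)
Lemma tilde_factor_inv : Num.min ((D / d) `^ (- N) * (D' / d') `^ (- N)) 1 =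
  (Num.max ((D / d) `^ N * (D' / d') `^ N) 1)^-1.
Proof.
rewrite !powRN -invfM; set m := _ * _.
have m0 : 0 < m by rewrite mulr_gt0 ?powR_gt0 ?r0.
have [m1|m1] := leP m 1.
  by rewrite invr1 min_r// invf_ge1.
by rewrite min_l// invf_le1// ltW.
Qed.

End scaling_factors.

Lemma lee_mulVl (R : realType) (k : R) (X Y : \bar R) : 0 < k ->
  (X <= k%:E * Y)%E -> ((k^-1)%:E * X <= Y)%E.
Proof. by move=> k0 XY; rewrite lee_pdivrMl. Qed.

Theorem corollary3p5 (R : realType) (n : nat) (hn : (0 < n)%N)
    (Oh : set 'cV[R]_n) (hOh : lipschitz_domain Oh)
    (x0 : 'cV[R]_n) (B : 'M[R]_n) (hB : B \in unitmx) :
  let F := fun xh : 'cV[R]_n => x0 + B *m xh in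
  let O := F @` Oh in
  let D := diam O in
  let Dh := diam Oh in
  let rho := chunkiness O in
  let rhoh := chunkiness Oh in
  let N : R := n%:R in
  (forall s : R, 0 < s < 1 -> forall v : 'cV[R]_n -> R, in_tildeHs O s v ->
    let vh := v \o F in
    ((D `^ (N - 2 * s) * rho `^ (- N) * Dh `^ (2 * s - N) * rhoh `^ (- (2 * s)))%:E
        * interp_L2_H10 Oh s vh ^+ 2
      <= interp_L2_H10 O s v ^+ 2
      <= (D `^ (N - 2 * s) * rho `^ (2 * s) * Dh `^ (2 * s - N) * rhoh `^ N)%:E
        * interp_L2_H10 Oh s vh ^+ 2)%E
    /\
    ((D `^ (N - 2 * s) * rho `^ (- N) * Dh `^ (2 * s - N) * rhoh `^ (- (2 * s))
          * Num.min (rho `^ (- N) * rhoh `^ (- N)) 1)%:E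
        * tilde_norm Oh s vh ^+ 2
      <= tilde_norm O s v ^+ 2
      <= (D `^ (N - 2 * s) * rho `^ (2 * s) * Dh `^ (2 * s - N) * rhoh `^ N
          * Num.max (rho `^ N * rhoh `^ N) 1)%:E
        * tilde_norm Oh s vh ^+ 2)%E)
  /\
  (forall s : R, 0 < s < 1 -> forall v : 'cV[R]_n -> R, in_Hs O s v ->
    let vh := v \o F in
    ((D `^ (N - 2 * s) * rho `^ (- N) * Dh `^ (2 * s - N) * rhoh `^ (- (2 * s)))%:E
        * interp_L2_H1 Oh s vh ^+ 2
      <= interp_L2_H1 O s v ^+ 2
      <= (D `^ (N - 2 * s) * rho `^ (2 * s) * Dh `^ (2 * s - N) * rhoh `^ N)%:E
        * interp_L2_H1 Oh s vh ^+ 2)%E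
    /\
    ((D `^ (N - 2 * s) * rho `^ (- (2 * N)) * Dh `^ (2 * s - N) * rhoh `^ (- N - 2 * s))%:E
        * slobodeckij Oh s vh ^+ 2
      <= slobodeckij O s v ^+ 2
      <= (D `^ (N - 2 * s) * rho `^ (N + 2 * s) * Dh `^ (2 * s - N) * rhoh `^ (2 * N))%:E
        * slobodeckij Oh s vh ^+ 2)%E).
Proof.
move=> F O D Dh rho rhoh N; have [neOh oOh bOh _ _] := hOh.
pose a := - (invmx B *m x0).
have uV : invmx B \in unitmx by rewrite unitmx_inv.
(* The pullback estimates concern preimages, so the image under F is rewritten as the preimage under
   its inverse. *)
have OE : O = (fun y => a + invmx B *m y) @^-1` Oh.
  apply/seteqP; split => [_ [x Ox <-]|y Oy] /=.
    by rewrite /F /a (affineK x0 hB x).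
  by exists (a + invmx B *m y) => //; rewrite /F /a (affineVK x0 hB y).
have OhE : (fun x => x0 + B *m x) @^-1` O = Oh.
  apply/seteqP; split => [x [y Oy /(can_inj (affineK x0 hB)) <-]//|x Ox].
  by exists x.
have oO : open O by rewrite OE; exact: open_affine_preimage.
have bO : bounded_set O by rewrite OE; exact: bounded_affine_preimage.
have neO : O !=set0 by have [x Ox] := neOh; exists (F x); exists x.
have D0 : 0 < D by exact: diam_gt0.
have Dh0 : 0 < Dh by exact: diam_gt0.
have d0 : 0 < inball_diam O by exact: inball_diam_gt0.
have dh0 : 0 < inball_diam Oh by exact: inball_diam_gt0.
have pos1 (e1 e2 : R) : 0 < (Dh / inball_diam O) `^ e1 * (D / inball_diam Oh) `^ e2.
  by rewrite mulr_gt0 ?powR_gt0 ?divr_gt0.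
have vE (v : 'cV[R]_n -> R) : (v \o F) \o (fun y => a + invmx B *m y) = v.
  by apply/funext => y /=; rewrite /F /a (affineVK x0 hB y).
have max0 : 0 < Num.max (rho `^ N * rhoh `^ N) 1 by rewrite lt_max ltr01 orbT.
split=> s /andP[s0 s1] v _ vh.
  (* Upper bounds: the inverse of F pulls functions on [Oh] back to [O], and v is the pullback of
     [vh]. *)
  have [up1 _ _ up4] := affine_scaling a hn uV oOh bOh neOh s0 vh.
  (* Lower bounds: F pulls v back to [Oh]; the constant, with the roles of the domains exchanged, is
     moved to the other side as its inverse. *)
  have [lo1 _ _ lo4] := affine_scaling x0 hn hB oO bO neO s0 v.
  move: up1 up4 lo1 lo4; rewrite -OE /vh vE OhE.
  have tf := tilde_factor N D0 d0 Dh0 dh0.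
  have tf' : (Dh / inball_diam O) `^ N * (D / inball_diam Oh) `^ N =
    (D / inball_diam O) `^ N * (Dh / inball_diam Oh) `^ N by rewrite [LHS]mulrC tf.
  move=> up1 up4 lo1 lo4.
  rewrite -/D -/Dh -/N tf in up4; rewrite -/D -/Dh -/N tf' in lo4.
  rewrite (interp_factor_inv N s D0 d0 Dh0 dh0) (interp_factor N s D0 d0 Dh0 dh0).
  rewrite (tilde_factor_inv N D0 d0 Dh0 dh0) -invfM.
  split; apply/andP; split.
  - by apply: lee_mulVl; [exact: pos1|exact: lo1].
  - exact: up1.
  - by apply: lee_mulVl; [rewrite mulr_gt0|exact: lo4].
  - exact: up4.
have [_ up2 up3 _] := affine_scaling a hn uV oOh bOh neOh s0 vh.
have [_ lo2 lo3 _] := affine_scaling x0 hn hB oO bO neO s0 v.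
move: up2 up3 lo2 lo3; rewrite -OE /vh vE OhE.
rewrite -/D -/Dh -/N => up2 up3 lo2 lo3.
rewrite (interp_factor_inv N s D0 d0 Dh0 dh0) (interp_factor N s D0 d0 Dh0 dh0).
rewrite (slobodeckij_factor_inv N s D0 d0 Dh0 dh0).
rewrite (slobodeckij_factor N s D0 d0 Dh0 dh0).
split; apply/andP; split.
- by apply: lee_mulVl; [exact: pos1|exact: lo2].
- exact: up2.
- apply: lee_mulVl; last exact: lo3.
  by rewrite mulr_gt0 ?exprn_gt0 ?powR_gt0 ?divr_gt0.
- exact: up3.
Qed.
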